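(* Let $\alpha\ge 1$ and $\beta\ge 1$. If there is a polynomial-time bicriteria $(\alpha,\beta)$-approximation algorithm for Precedence Constrained Set Cover (PCSC), then there is a polynomial-time $\mathcal{O}\!\left(\frac{\alpha}{\log\left(\frac{5\beta}{5\beta-1}\right)}\cdot \log n\right)$-approximation algorithm for Precedence Constrained Worst Case Decision Tree (PCWCDT), where $n$ is the number of hypotheses.
   Context: Decision trees: $\mathcal{H}$ is a set of $n$ hypotheses and $\mathcal{T}$ a set of $m$ tests; each test $t\in\mathcal{T}$ is a partition of $\mathcal{H}$. An unknown target $h^*\in\mathcal{H}$ is to be identified; performing $t$ reveals the part $H\in t$ containing $h^*$. A decision tree is a rooted tree whose internal nodes are tests, whose edges out of a test are labeled by its replies (parts), and whose leaves correspond to identified hypotheses (the hypotheses consistent with the replies along the root-leaf path determine the leaf's hypothesis uniquely). A partial order $\preceq$ on $\mathcal{T}$ is given; a decision tree is precedence-closed if for every node, the tests on the root-to-node path form a sequence in which every predecessor (w.r.t. $\preceq$) of each test appears earlier on the path. For a hypothesis $h$, $\mathrm{COST}(D,h)$ is the number of tests on the path from the root to the leaf identifying $h$. $\mathrm{COST}_W(D)=\max_{h\in\mathcal{H}}\mathrm{COST}(D,h)$. PCWCDT: given $(\mathcal{H},\mathcal{T},\preceq)$, find a precedence-closed decision tree minimizing $\mathrm{COST}_W$; an $\alpha$-approximation returns a precedence-closed decision tree of cost at most $\alpha$ times the optimum. Set cover: a universe $\mathcal{U}$ of $n$ items, a family $\mathcal{S}$ of $m$ subsets of $\mathcal{U}$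 with $\bigcup\mathcal{S}=\mathcal{U}$, a partial order $\preceq$ on $\mathcal{S}$. A subfamily $\mathcal{C}\subseteq\mathcal{S}$ is precedence-closed if $x\in\mathcal{C}$, $y\preceq x$ imply $y\in\mathcal{C}$; $\mathrm{cov}(\mathcal{C})=\bigcup_{C\in\mathcal{C}}C$. PCSC: given $(\mathcal{U},\mathcal{S},\preceq,f)$ with $0<f\le 1$, find a precedence-closed $\mathcal{C}$ with $|\mathrm{cov}(\mathcal{C})|\ge f n$ minimizing $|\mathcal{C}|$. An $(\alpha,\beta)$-approximation for PCSC returns, on every instance $\mathcal{I}$, a precedence-closed $\mathcal{C}$ with $|\mathrm{cov}(\mathcal{C})|\ge f n/\beta$ and $|\mathcal{C}|\le \alpha\cdot \mathrm{OPT}(\mathcal{I})$. *)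

(* Defs.v *)
From mathcomp Require Import all_boot all_order all_algebra.
From mathcomp Require Import reals exp.

Set Implicit Arguments.
Unset Strict Implicit.
Unset Printing Implicit Defensive.
Import Order.TTheory GRing.Theory Num.Theory.

(* The machine model is Jones's WHILE language on binary trees, in
   variable-free (combinator) form: a program maps one tree to one tree, and
   [Nil] plays the role of false. *)

Inductive data := Nil | Cons of data & data.

Fixpoint dsize (x : data) : nat :=
  if x is Cons a b then (dsize a + dsize b).+1 else 1.

Definition hd (x : data) : data := if x is Cons a _ then a else Nil.
Definition tl (x : data) : data := if x is Cons _ b then b else Nil.

Inductive prog :=
  | PId
  | PNil
  | PHd
  | PTl
  | PCons of prog & prog
  | PSeq of prog & prog              (* first program runs first *)
  | PIf of prog & prog & prog
  | PWhile of prog & prog.           (* test, body *)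

(* [run p x y t]: on input [x], [p] halts with output [y] in time [t].
   Every construct is charged the full size of the tree it is applied to, and
   not one unit; hence the time bounds the size of every intermediate value
   ([PCons PId PId] cannot build exponentially large trees in linear time), and
   time in this model and on multitape Turing machines differ by at most a
   polynomial. *)
Inductive run : prog -> data -> data -> nat -> Prop :=
  | run_id x : run PId x x (dsize x)
  | run_nil x : run PNil x Nil (dsize x)
  | run_hd x : run PHd x (hd x) (dsize x)
  | run_tl x : run PTl x (tl x) (dsize x)
  | run_cons p q x a b t u :
      run p x a t -> run q x b u ->
      run (PCons p q) x (Cons a b) (dsize x + t + u)
  | run_seq p q x y z t u :
      run p x y t -> run q y z u ->
      run (PSeq p q) x z (dsize x + t + u)
  | run_if_true p q r x a b y t u :
      run p x (Cons a b) t -> run q x y u ->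
      run (PIf p q r) x y (dsize x + t + u)
  | run_if_false p q r x y t u :
      run p x Nil t -> run r x y u ->
      run (PIf p q r) x y (dsize x + t + u)
  | run_while_stop p q x t :
      run p x Nil t ->
      run (PWhile p q) x x (dsize x + t)
  | run_while_step p q x a b y z t u v :
      run p x (Cons a b) t -> run q x y u -> run (PWhile p q) y z v ->
      run (PWhile p q) x z (dsize x + t + u + v).

(* Indices of hypotheses, items, tests and sets are written in unary; they are
   smaller than the number of such objects listed in the instance, so this is
   harmless. Genuine numbers (the fraction of a set cover instance) are written
   in binary. *)

Definition enc_seq (s : seq data) : data := foldr Cons Nil s.

Definition enc_bool (b : bool) : data := if b then Cons Nil Nil else Nil.

Definition enc_unary (k : nat) : data := enc_seq (nseq k Nil).

(* least significant bit first *)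
Definition enc_binary (k : nat) : data :=
  enc_seq (mkseq (fun i => enc_bool (odd (k %/ 2 ^ i))) (trunc_log 2 k).+1).

Definition enc_set (n : nat) (A : {set 'I_n}) : data :=
  enc_seq [seq enc_bool (i \in A) | i <- enum 'I_n].

Definition enc_rel (n : nat) (r : rel 'I_n) : data :=
  enc_seq [seq enc_seq [seq enc_bool (r i j) | j <- enum 'I_n]
          | i <- enum 'I_n].

(* Every instance [x] satisfying [dom] must be answered by some [good] output;
   on the other inputs the program is unconstrained. As [1 <= dsize _], the
   bounds [c * s ^ k] dominate all polynomials. *)
Definition polytime_solvable (I : Type) (O : I -> Type)
    (enc_in : I -> data) (enc_out : forall x, O x -> data)
    (dom : I -> Prop) (good : forall x, O x -> Prop) : Prop :=
  exists (p : prog) (c k : nat), forall x : I, dom x ->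
    exists (y : O x) (t : nat),
      [/\ run p (enc_in x) (enc_out x y) t,
          t <= c * dsize (enc_in x) ^ k
        & good x y].

Definition is_min (T : Type) (P : T -> Prop) (f : T -> nat) (k : nat) : Prop :=
  (exists2 y, P y & f y = k) /\ (forall y, P y -> k <= f y).

Definition partial_order (T : Type) (r : rel T) : Prop :=
  [/\ reflexive r, antisymmetric r & transitive r].

(** Precedence constrained set cover *)

Record pcsc := Pcsc {
  sc_n : nat;
  sc_m : nat;
  sc_set : 'I_sc_m -> {set 'I_sc_n};
  sc_prec : rel 'I_sc_m;
  sc_f : rat;
  sc_prec_order : partial_order sc_prec;
  sc_cover : \bigcup_i sc_set i = [set: 'I_sc_n];
  sc_f_bounds : (0 < sc_f <= 1)%R
}.

Definition cov (I : pcsc) (C : {set 'I_(sc_m I)}) : {set 'I_(sc_n I)} :=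
  \bigcup_(i in C) sc_set i.

Definition sc_closed (I : pcsc) (C : {set 'I_(sc_m I)}) : Prop :=
  forall x y, x \in C -> sc_prec y x -> y \in C.

(* covers at least a fraction [g] of the universe *)
Definition sc_feasible (R : realType) (I : pcsc) (g : R)
    (C : {set 'I_(sc_m I)}) : Prop :=
  sc_closed C /\ (g * (sc_n I)%:R <= #|cov C|%:R)%R.

Definition enc_pcsc (I : pcsc) : data :=
  enc_seq [:: enc_unary (sc_n I);
              enc_unary (sc_m I);
              enc_seq [seq enc_set (sc_set i) | i <- enum 'I_(sc_m I)];
              enc_rel (@sc_prec I);
              enc_binary `|numq (sc_f I)|;
              enc_binary `|denq (sc_f I)|].

Definition pcsc_approx (R : realType) (alpha beta : R) : Prop :=
  @polytime_solvable pcsc (fun I => {set 'I_(sc_m I)})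
    enc_pcsc (fun I C => enc_set C) (fun=> True)
    (fun I C =>
       sc_feasible (ratr (sc_f I) / beta)%R C /\
       forall opt, is_min (@sc_feasible R I (ratr (sc_f I))) (fun C' => #|C'|) opt ->
         (#|C|%:R <= alpha * opt%:R)%R).

(** Precedence constrained worst case decision tree *)

Record pcwcdt := Pcwcdt {
  dt_n : nat;
  dt_m : nat;
  dt_test : 'I_dt_m -> {set {set 'I_dt_n}};
  dt_prec : rel 'I_dt_m;
  dt_n_gt0 : 0 < dt_n;
  dt_test_partition : forall t, partition (dt_test t) [set: 'I_dt_n];
  dt_prec_order : partial_order dt_prec
}.

(* The second argument of [Node] lists the outgoing edges, each given by its
   label (a reply) and the subtree it leads to. *)
Inductive dtree (n m : nat) :=
  | Leaf of 'I_n
  | Node of 'I_m & seq ({set 'I_n} * dtree n m).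

(* [identifies X D]: [D] is a decision tree when the target is only known to be
   in [X]. A test node has exactly one edge for each reply that some hypothesis
   of [X] can produce. *)
Fixpoint identifies (I : pcwcdt) (X : {set 'I_(dt_n I)})
    (D : dtree (dt_n I) (dt_m I)) : bool :=
  match D with
  | Leaf h => X == [set h]
  | Node t c =>
      [&& uniq [seq e.1 | e <- c],
          [set P in [seq e.1 | e <- c]] ==
            [set P in dt_test t | P :&: X != set0]
        & all (fun e => identifies (e.1 :&: X) e.2) c]
  end.

(* [path] is the set of tests met strictly above the root of [D]. *)
Fixpoint dt_closed (I : pcwcdt) (path : {set 'I_(dt_m I)})
    (D : dtree (dt_n I) (dt_m I)) : bool :=
  match D with
  | Leaf _ => true
  | Node t c =>
      [forall s, (dt_prec s t && (s != t)) ==> (s \in path)] &&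
      all (fun e => dt_closed (t |: path) e.2) c
  end.

Definition pc_dtree (I : pcwcdt) (D : dtree (dt_n I) (dt_m I)) : Prop :=
  identifies [set: 'I_(dt_n I)] D /\ dt_closed set0 D.

Fixpoint cost (n m : nat) (D : dtree n m) (h : 'I_n) : nat :=
  match D with
  | Leaf _ => 0
  | Node _ c =>
      (foldr (fun (e : {set 'I_n} * dtree n m) k =>
                if h \in e.1 then cost e.2 h else k) 0 c).+1
  end.

Definition cost_W (n m : nat) (D : dtree n m) : nat := \max_(h < n) cost D h.

(* A test is written as the matrix of the equivalence relation it induces. *)
Definition enc_pcwcdt (I : pcwcdt) : data :=
  enc_seq [:: enc_unary (dt_n I);
              enc_unary (dt_m I);
              enc_seq [seq enc_rel [rel h h' | h' \in pblock (dt_test t) h]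
                      | t <- enum 'I_(dt_m I)];
              enc_rel (@dt_prec I)].

Fixpoint enc_dtree (n m : nat) (D : dtree n m) : data :=
  match D with
  | Leaf h => Cons Nil (enc_unary h)
  | Node t c =>
      Cons (Cons Nil Nil)
        (Cons (enc_unary t)
              (enc_seq [seq Cons (enc_set e.1) (enc_dtree e.2) | e <- c]))
  end.

(* The approximation ratio [rho] depends on the number of hypotheses. Only
   instances having some precedence-closed decision tree need be answered. *)
Definition pcwcdt_approx (R : realType) (rho : nat -> R) : Prop :=
  @polytime_solvable pcwcdt (fun I => dtree (dt_n I) (dt_m I))
    enc_pcwcdt (fun I D => enc_dtree D)
    (fun I => exists D, @pc_dtree I D)
    (fun I D =>
       pc_dtree D /\
       forall opt, is_min (@pc_dtree I) (@cost_W _ _) opt ->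
         ((cost_W D)%:R <= rho (dt_n I) * opt%:R)%R).

(* Main.v *)
(* Keep the set X of hypotheses still possible. Call a test light at h when the
   part of h contains at most half of X. At most one part of a test is heavy, so
   any decision tree has a root-leaf path that follows heavy parts as long as
   possible, and at all elements of X but one some test on it is light. Hence
   the optimum of the set cover instance "cover half of X by the sets of
   elements at which a test is light" is at most the depth of the tree.
   Performing all tests of an approximate cover, predecessors first, leaves at
   most |X|/2 hypotheses if one of them is light at the target, and otherwise
   only uncovered ones, at most (1 - 1/(2 beta)) |X| in number. As X shrinks by
   a factor q = 5 beta/(5 beta - 1) or more in each such phase, ln n / ln q
   phases suffice. *)
Require Import Defs.
From mathcomp Require Import all_boot all_order all_algebra.
From mathcomp Require Import zify ring lra.
From mathcomp Require Import boolp reals exp.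

Set Implicit Arguments.
Unset Strict Implicit.
Unset Printing Implicit Defensive.
Import Order.TTheory GRing.Theory Num.Theory.
(* [Nil] and [Cons] would otherwise be those of [seq]. *)
Import Defs.

(** * Polynomial time in the WHILE language *)

(** Both bounds on the fraction of [X] that a phase leaves, 1/2 and 1 - 1/(2 beta), are at most 1/q
    = 1 - 1/(5 beta); they would be so with 2 in place of 5. A single decision tree for all
    hypotheses bounds the set cover optimum of every phase, whatever [X] has become by then. The
    main burden is the running time: the machine has no recursion, while the construction branches
    at every reply and calls the set cover program on the way. The tree is therefore defined by
    recursion on fuel, and a stack machine with an explicit list of tasks carries the recursion out.
    Two facts keep this polynomial: sibling nodes have disjoint hypothesis sets, which bounds the
    number of steps, and a step enlarges the configuration by an amount that depends on the instance
    only. Programs are hardly ever written down; they arise from closure properties of [ptime], a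
    relation between an encoding of inputs and an encoding of outputs. *)

Lemma dsize_gt0 d : 0 < dsize d.
Proof. by case: d. Qed.

Lemma dsize_hd d : dsize (hd d) <= dsize d.
Proof. by case: d => //= a b; lia. Qed.

Lemma dsize_tl d : dsize (tl d) <= dsize d.
Proof. by case: d => //= a b; lia. Qed.

Lemma run_dsize p x y t : run p x y t -> dsize y <= t.
Proof.
elim=> {p x y t} //=.
- exact: dsize_gt0.
- exact: dsize_hd.
- exact: dsize_tl.
- by move=> p q x *; have := dsize_gt0 x; lia.
all: by move=> *; lia.
Qed.

Definition poly_bounded (T : nat -> nat) : Prop :=
  exists c k, forall s, 0 < s -> T s <= c * s ^ k.

Lemma poly_bounded_const n : poly_bounded (fun=> n).
Proof. by exists n, 0 => s _; rewrite expn0 muln1. Qed.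

Lemma poly_bounded_id : poly_bounded id.
Proof. by exists 1, 1 => s _; rewrite mul1n expn1. Qed.

Lemma poly_bounded_add T U :
  poly_bounded T -> poly_bounded U -> poly_bounded (fun s => T s + U s).
Proof.
move=> [c [k H]] [d [l K]]; exists (c + d), (k + l) => s s0.
rewrite mulnDl leq_add //.
  apply: leq_trans (H s s0) _.
  by rewrite leq_mul2l leq_pexp2l ?leq_addr ?orbT.
apply: leq_trans (K s s0) _.
by rewrite leq_mul2l leq_pexp2l ?leq_addl ?orbT.
Qed.

Lemma poly_bounded_mul T U :
  poly_bounded T -> poly_bounded U -> poly_bounded (fun s => T s * U s).
Proof.
move=> [c [k H]] [d [l K]]; exists (c * d), (k + l) => s s0.
by rewrite expnD mulnACA leq_mul ?H ?K.
Qed.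

Lemma poly_bounded_exp T k :
  poly_bounded T -> poly_bounded (fun s => T s ^ k).
Proof.
move=> [c [l H]]; exists (c ^ k), (l * k) => s s0.
by rewrite expnM -expnMn; case: k => // k; rewrite leq_exp2r // H.
Qed.

Ltac poly_bound :=
  repeat (first [ exact: poly_bounded_id | exact: poly_bounded_const
    | assumption
    | apply: poly_bounded_add | apply: poly_bounded_mul
    | apply: poly_bounded_exp ]).

Lemma leq_exp c k x y : x <= y -> c * x ^ k <= c * y ^ k.
Proof.
by move=> xy; case: k => [|k]; rewrite ?expn0 // leq_mul2l leq_exp2r // xy orbT.
Qed.

(* The output is given in encoded form only, so that its type may depend on
   [a]. *)
Definition ptime (A : Type) (ea fa : A -> data) : Prop :=
  exists p c k, forall a,
    exists2 t, run p (ea a) (fa a) t & t <= c * dsize (ea a) ^ k.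

Lemma ptime_poly A (ea fa : A -> data) p T :
  poly_bounded T ->
  (forall a, exists2 t, run p (ea a) (fa a) t & t <= T (dsize (ea a))) ->
  ptime ea fa.
Proof.
move=> [c [k H]] K; exists p, c, k => a; have [t r ht] := K a.
by exists t => //; apply: leq_trans ht (H _ (dsize_gt0 _)).
Qed.

(** Outputs of polynomial size are what makes sequences of programs and loop bounds polynomial
    again. *)
Lemma ptime_dsize A (ea fa : A -> data) : ptime ea fa ->
  exists c k, forall a, dsize (fa a) <= c * dsize (ea a) ^ k.
Proof.
move=> [p [c [k H]]]; exists c, k => a; have [t r ht] := H a.
by apply: leq_trans ht; apply: run_dsize r.
Qed.

Lemma ptime_eq A (ea fa ga : A -> data) :
  ptime ea fa -> (forall a, fa a = ga a) -> ptime ea ga.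
Proof. by move=> + /funext <-. Qed.

Lemma ptime_pre A B (ea : A -> data) (eb fb : B -> data) (h : A -> B) :
  ptime eb fb -> (forall a, ea a = eb (h a)) -> ptime ea (fun a => fb (h a)).
Proof.
by move=> [p [c [k H]]] E; exists p, c, k => a; rewrite E; exact: H.
Qed.

Lemma ptime_id A (ea : A -> data) : ptime ea ea.
Proof.
by exists PId, 1, 1 => a; exists (dsize (ea a)); [exact: run_id | rewrite mul1n].
Qed.

Lemma ptime_nil A (ea : A -> data) : ptime ea (fun=> Nil).
Proof.
by exists PNil, 1, 1 => a; exists (dsize (ea a)); [exact: run_nil | rewrite mul1n].
Qed.

Lemma ptime_seq A (ea fa ga : A -> data) :
  ptime ea fa -> ptime fa ga -> ptime ea ga.
Proof.
move=> [p [c [k H]]] [q [d [l K]]].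
apply: (@ptime_poly _ _ _ (PSeq p q)
  (fun s => s + c * s ^ k + d * (c * s ^ k) ^ l)); first by poly_bound.
move=> a; have [t r ht] := H a; have [u r' hu] := K a.
exists (dsize (ea a) + t + u); first exact: run_seq r r'.
rewrite !leq_add //; apply: leq_trans hu _; apply: leq_exp.
by apply: leq_trans ht; apply: run_dsize r.
Qed.

Lemma ptime_comp A B (ea : A -> data) (eb fb : B -> data) (h : A -> B) :
  ptime ea (fun a => eb (h a)) -> ptime eb fb -> ptime ea (fun a => fb (h a)).
Proof. by move=> H K; apply: ptime_seq H _; apply: ptime_pre K _. Qed.

Lemma ptime_hd A (ea fa : A -> data) :
  ptime ea fa -> ptime ea (fun a => hd (fa a)).
Proof.
move=> H; apply: ptime_seq H _; exists PHd, 1, 1 => a.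
by exists (dsize (fa a)); [exact: run_hd | rewrite mul1n].
Qed.

Lemma ptime_tl A (ea fa : A -> data) :
  ptime ea fa -> ptime ea (fun a => tl (fa a)).
Proof.
move=> H; apply: ptime_seq H _; exists PTl, 1, 1 => a.
by exists (dsize (fa a)); [exact: run_tl | rewrite mul1n].
Qed.

Lemma ptime_cons A (ea fa ga : A -> data) :
  ptime ea fa -> ptime ea ga -> ptime ea (fun a => Cons (fa a) (ga a)).
Proof.
move=> [p [c [k H]]] [q [d [l K]]].
apply: (@ptime_poly _ _ _ (PCons p q) (fun s => s + c * s ^ k + d * s ^ l)).
  by poly_bound.
move=> a; have [t r ht] := H a; have [u r' hu] := K a.
exists (dsize (ea a) + t + u); first exact: run_cons r r'.
by rewrite !leq_add.
Qed.

Lemma ptime_const A (ea : A -> data) d : ptime ea (fun=> d).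
Proof. by elim: d => [|d1 H d2 K]; [exact: ptime_nil | exact: ptime_cons]. Qed.

Definition truthy (d : data) : bool := if d is Cons _ _ then true else false.

Lemma truthy_bool b : truthy (enc_bool b) = b.
Proof. by case: b. Qed.

(** Each branch may view the input as an element of another type, on which its shape is exposed: a
    non-empty list as a head and a tail, say. *)
Lemma ptime_case A A1 A2 (ea fa ta : A -> data) (e1 f1 : A1 -> data)
    (e2 f2 : A2 -> data) :
  ptime ea ta -> ptime e1 f1 -> ptime e2 f2 ->
  (forall a, truthy (ta a) -> exists2 x, ea a = e1 x & fa a = f1 x) ->
  (forall a, ~~ truthy (ta a) -> exists2 x, ea a = e2 x & fa a = f2 x) ->
  ptime ea fa.
Proof.
move=> [p [c [k H]]] [q [d [l K]]] [r [e [j L]]] C1 C2.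
apply: (@ptime_poly _ _ _ (PIf p q r)
  (fun s => s + c * s ^ k + (d * s ^ l + e * s ^ j))); first by poly_bound.
move=> a; have [t rt ht] := H a; move: rt (C1 a) (C2 a).
case: (ta a) => [|x y] rt /= h1 h2.
  have [x E ->] := h2 isT; have [u ru hu] := L x; rewrite -!E in ru hu.
  exists (dsize (ea a) + t + u); first exact: run_if_false rt ru.
  by rewrite leq_add ?leq_add //; apply: leq_trans hu (leq_addl _ _).
have [z E ->] := h1 isT; have [u ru hu] := K z; rewrite -!E in ru hu.
exists (dsize (ea a) + t + u); first exact: run_if_true rt ru.
by rewrite leq_add ?leq_add //; apply: leq_trans hu (leq_addr _ _).
Qed.

Lemma ptime_ifd A (ea ta fa ga : A -> data) :
  ptime ea ta -> ptime ea fa -> ptime ea ga ->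
  ptime ea (fun a => if truthy (ta a) then fa a else ga a).
Proof.
move=> H K L; apply: ptime_case H K L _ _ => a; first by move->; exists a.
by move/negbTE->; exists a.
Qed.

Lemma ptime_if A (ea fa ga : A -> data) (b : A -> bool) :
  ptime ea (fun a => enc_bool (b a)) -> ptime ea fa -> ptime ea ga ->
  ptime ea (fun a => if b a then fa a else ga a).
Proof.
move=> H K L; apply: ptime_eq (ptime_ifd H K L) _ => a.
by rewrite truthy_bool.
Qed.

Lemma ptime_neg A (ea : A -> data) (b : A -> bool) :
  ptime ea (fun a => enc_bool (b a)) -> ptime ea (fun a => enc_bool (~~ b a)).
Proof.
move=> H.
apply: ptime_eq (ptime_if H (ptime_const _ (enc_bool false))
  (ptime_const _ (enc_bool true))) _.
by move=> a; case: (b a).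
Qed.

Lemma ptime_and A (ea : A -> data) (b c : A -> bool) :
  ptime ea (fun a => enc_bool (b a)) -> ptime ea (fun a => enc_bool (c a)) ->
  ptime ea (fun a => enc_bool (b a && c a)).
Proof.
move=> H K; apply: ptime_eq (ptime_if H K (ptime_const _ (enc_bool false))) _.
by move=> a; case: (b a).
Qed.

Lemma ptime_imp A (ea : A -> data) (b c : A -> bool) :
  ptime ea (fun a => enc_bool (b a)) -> ptime ea (fun a => enc_bool (c a)) ->
  ptime ea (fun a => enc_bool (b a ==> c a)).
Proof.
move=> H K; apply: ptime_eq (ptime_if H K (ptime_const _ (enc_bool true))) _.
by move=> a; case: (b a).
Qed.

(** [U] and [V] bound one run of the test and of the body on states of size at most [B]. If the test
    fails early, the remaining iterations of [step] change nothing, so the result is still the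
    [N]-th iterate. *)
Lemma run_while p q S (es ts : S -> data) (step : S -> S) N B U V s :
  (forall i, i <= N -> dsize (es (iter i step s)) <= B) ->
  (forall s, ~~ truthy (ts s) -> step s = s) ->
  ~~ truthy (ts (iter N step s)) ->
  (forall s, dsize (es s) <= B -> exists2 t, run p (es s) (ts s) t & t <= U) ->
  (forall s, dsize (es s) <= B ->
    exists2 t, run q (es s) (es (step s)) t & t <= V) ->
  exists2 t, run (PWhile p q) (es s) (es (iter N step s)) t
    & t <= N.+1 * (B + U + V).
Proof.
move=> + fixed + P Q; elim: N s => [|N IH] s hB stop.
  have [t r ht] := P s (hB 0 (leqnn _)); move: stop => /= stop.
  exists (dsize (es s) + t); last by have := hB 0 (leqnn _) => /=; lia.
  by apply: run_while_stop; case: (ts s) r stop.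
have hs := hB 0 (leq0n _); rewrite /= in hs.
have [t r ht] := P s hs.
case E: (truthy (ts s)); last first.
  have st := fixed _ (negbT E).
  have it n : iter n step s = s by elim: n => //= n ->.
  exists (dsize (es s) + t); last by rewrite !mulSn; lia.
  by rewrite it; apply: run_while_stop; case: (ts s) r E.
have [u ru hu] := Q s hs.
have [||v rv hv] := IH (step s).
- by move=> i iN; rewrite -iterSr; apply: hB.
- by rewrite -iterSr.
exists (dsize (es s) + t + u + v); last by rewrite mulSn; lia.
rewrite iterSr; case: (ts s) r E => // x y r _.
by apply: run_while_step r ru rv.
Qed.

(* As [step] is constant once the test fails, [N] need only bound the number of
   rounds. *)
Lemma ptime_while A S (ea : A -> data) (es ts : S -> data) (step : S -> S)
    (init : A -> S) (N : A -> nat) P :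
  ptime ea (fun a => es (init a)) -> ptime es ts ->
  ptime es (fun s => es (step s)) ->
  poly_bounded P ->
  (forall a, N a <= P (dsize (ea a))) ->
  (forall a i, i <= N a ->
    dsize (es (iter i step (init a))) <= P (dsize (ea a))) ->
  (forall s, ~~ truthy (ts s) -> step s = s) ->
  (forall a, ~~ truthy (ts (iter (N a) step (init a)))) ->
  ptime ea (fun a => es (iter (N a) step (init a))).
Proof.
move=> [r [e [j H]]] [p [c [k K]]] [q [d [l L]]] polyP NP sP fixed stop.
apply: (@ptime_poly _ _ _ (PSeq r (PWhile p q)) (fun s => s + e * s ^ j +
  (P s).+1 * (P s + c * P s ^ k + d * P s ^ l))).
  under eq_fun => s do rewrite mulSn.
  by poly_bound.
move=> a; have [t rt ht] := H a.
pose B := P (dsize (ea a)).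
have [||u ru hu] := @run_while p q _ es ts step (N a) B (c * B ^ k) (d * B ^ l)
  (init a) (sP a) fixed (stop a).
- move=> s hs; have [u ru hu] := K s; exists u => //.
  by apply: leq_trans hu _; apply: leq_exp hs.
- move=> s hs; have [u ru hu] := L s; exists u => //.
  by apply: leq_trans hu _; apply: leq_exp hs.
exists (dsize (ea a) + t + u); first exact: run_seq rt ru.
rewrite !leq_add //; apply: leq_trans hu _.
by rewrite leq_mul2r ltnS NP orbT.
Qed.

(** * Loops over lists, with a context for the loop variable *)

Lemma dsize_enc_seq s : dsize (enc_seq s) = (sumn (map dsize s) + size s).+1.
Proof. by elim: s => //= x s ->; lia. Qed.

(** A context extended by a bound variable, whose type may depend on the context. Bodies of loops
    and comprehensions are programs on such pairs. *)
Definition ext (A : Type) (T : A -> Type) (ea : A -> data)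
    (el : forall a, T a -> data) (p : {a & T a}) : data :=
  Cons (ea (tag p)) (el (tag p) (tagged p)).

Lemma ptime_weak A (T : A -> Type) (ea : A -> data) (el : forall a, T a -> data)
    (fa : A -> data) :
  ptime ea fa -> ptime (ext ea el) (fun p => fa (tag p)).
Proof.
move=> H; apply: ptime_comp (H).
exact: ptime_hd (ptime_id (ext ea el)).
Qed.

Lemma ptime_var A (T : A -> Type) (ea : A -> data) (el : forall a, T a -> data) :
  ptime (ext ea el) (fun p => el (tag p) (tagged p)).
Proof. exact: ptime_tl (ptime_id (ext ea el)). Qed.

(** Polynomial time of one round is not enough: a round that doubles the accumulator would make it
    exponential. Hence the separate size bound on all partial results. The loop state holds the
    context, the rest of the list and the accumulator. *)
Lemma ptime_fold A (T : A -> Type) (ea u0 : A -> data)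
    (el : forall a, T a -> data) (l : forall a, seq (T a))
    (g : forall a, T a -> data -> data) P :
  ptime ea (fun a => enc_seq [seq el a x | x <- l a]) ->
  ptime ea u0 ->
  ptime (fun p : {a & T a} * data => Cons (ext ea el p.1) p.2)
    (fun p => g (tag p.1) (tagged p.1) p.2) ->
  poly_bounded P ->
  (forall a i, dsize (foldl (fun d x => g a x d) (u0 a) (take i (l a)))
     <= P (dsize (ea a))) ->
  ptime ea (fun a => foldl (fun d x => g a x d) (u0 a) (l a)).
Proof.
move=> Hl Hu Hg polyP hP.
pose S := {a & (seq (T a) * data)%type}.
pose es (s : S) := Cons (ea (tag s))
  (Cons (enc_seq (map (el (tag s)) (tagged s).1)) (tagged s).2).
pose step (s : S) : S := let: existT a (r, d) := s in
  existT _ a (if r is x :: r' then (r', g a x d) else (r, d)).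
pose init a : S := existT _ a (l a, u0 a).
have iterE a i : iter i step (init a) =
    existT _ a (drop i (l a), foldl (fun d x => g a x d) (u0 a) (take i (l a))).
  elim: i => [|i IH]; first by rewrite drop0 take0.
  rewrite iterS IH /=; congr existT.
  case: (ltnP i (size (l a))) => h; last first.
    by rewrite !drop_oversize ?take_oversize // ltnW.
  case E: (l a) h => [//|x0 r0] h.
  rewrite -E in h *; rewrite (drop_nth x0 h) (take_nth x0 h).
  by rewrite -cats1 foldl_cat.
have [c [k hl]] := ptime_dsize Hl.
have fin : ptime ea (fun a => es (iter (size (l a)) step (init a))).
  apply: (@ptime_while _ _ _ es (fun s => enc_seq (map (el (tag s)) (tagged s).1))
    step _ _ (fun s => s + (c * s ^ k + P s).+2)).
  - by apply: ptime_cons (ptime_id _) _; apply: ptime_cons.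
  - exact: (ptime_hd (ptime_tl (ptime_id es))).
  - have Hts : ptime es (fun s => enc_seq (map (el (tag s)) (tagged s).1)).
      exact: (ptime_hd (ptime_tl (ptime_id es))).
    (* A state with a non-empty list is viewed as a bound variable in its context, a tail and an
       accumulator, the form that [Hg] expects. *)
    apply: (@ptime_case _ ({a & T a} * seq data * data) S _ _ _
      (fun p => Cons (ea (tag p.1.1))
        (Cons (Cons (el _ (tagged p.1.1)) (enc_seq p.1.2)) p.2))
      (fun p => Cons (ea (tag p.1.1)) (Cons (enc_seq p.1.2) (g _ (tagged p.1.1) p.2)))
      es es Hts).
    + set e := fun p : _ * _ => _.
      have He : ptime e e by exact: ptime_id.
      have H1 := ptime_hd He; have H2 := ptime_tl He.
      apply: ptime_cons (H1) _; apply: ptime_cons.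
        exact: ptime_tl (ptime_hd H2).
      apply: (@ptime_comp _ _ e _ _ (fun p => (p.1.1, p.2)) _ Hg).
      apply: ptime_cons (ptime_tl H2); apply: ptime_cons H1 _.
      exact: ptime_hd (ptime_hd H2).
    + exact: ptime_id.
    + move=> [a [[|x r] d]] //= _.
      by exists (existT _ a x, map (el a) r, d).
    + by move=> [a [[|x r] d]] //= _; exists (existT _ a ([::], d)).
  - under eq_fun => s do rewrite -addn2.
    by poly_bound.
  - move=> a; have := hl a; rewrite dsize_enc_seq size_map; lia.
  - move=> a i _; rewrite iterE /es /=.
    have : dsize (enc_seq (map (el a) (drop i (l a)))) <= c * dsize (ea a) ^ k.
      apply: leq_trans (hl a); rewrite map_drop; move: (map _ _) => s.
      elim: s i {iterE} => [|x s IH] [|i] //=.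
      by apply: leq_trans (IH i) _; lia.
    have := hP a i; lia.
  - by move=> [a [[|x r] d]].
  - by move=> a; rewrite iterE /= drop_size.
apply: ptime_eq (ptime_tl (ptime_tl fin)) _ => a.
by rewrite iterE /= take_size.
Qed.

(** * List programs *)

Section Comprehension.
Variables (A : Type) (T : A -> Type) (ea : A -> data).
Variables (el : forall a, T a -> data) (l : forall a, seq (T a)).
Hypothesis ptime_l : ptime ea (fun a => enc_seq [seq el x | x <- l a]).

(** A fold pushes its results on the accumulator, so they come out reversed. Reversal,
    concatenation, map and filter are all instances of this. *)
Lemma ptime_compr_catrev (b : forall a, T a -> bool) (f : forall a, T a -> data)
    (r : A -> seq data) :
  ptime ea (fun a => enc_seq (r a)) ->
  ptime (ext ea el) (fun p => enc_bool (b (tag p) (tagged p))) ->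
  ptime (ext ea el) (fun p => f (tag p) (tagged p)) ->
  ptime ea (fun a => enc_seq (catrev [seq f a x | x <- l a & b a x] (r a))).
Proof.
move=> Hr Hb Hf.
pose g a (x : T a) d := if b a x then Cons (f a x) d else d.
have gE a s t : foldl (fun d x => g a x d) (enc_seq t) s =
    enc_seq (catrev [seq f a x | x <- s & b a x] t).
  elim: s t => //= x s IH t; rewrite /g; case: ifP => _ //.
  exact: (IH (f a x :: t)).
have [c [k hr]] := ptime_dsize Hr.
have [d [j hl]] := ptime_dsize ptime_l.
have [e [i hf]] := ptime_dsize Hf.
suff: ptime ea (fun a => foldl (fun d x => g a x d) (enc_seq (r a)) (l a)).
  by move=> H; apply: ptime_eq H _ => a; rewrite gE.
(* An element adds one cell and the value of [f], which is polynomial in the context and the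
   element; the element is no larger than the whole list. *)
pose P s := c * s ^ k + d * s ^ j * (1 + e * (1 + s + d * s ^ j) ^ i).
apply: (ptime_fold ptime_l Hr (g := g) (P := P)).
- set e' := fun p : _ * _ => _.
  have He : ptime e' e' by exact: ptime_id.
  apply: ptime_if.
  + exact: (ptime_comp (h := fst) (ptime_hd He) Hb).
  + apply: ptime_cons (ptime_tl He).
    exact: (ptime_comp (h := fst) (ptime_hd He) Hf).
  + exact: ptime_tl He.
- by rewrite /P; poly_bound.
- move=> a i0; rewrite gE.
  set F := 1 + e * (1 + dsize (ea a) + d * dsize (ea a) ^ j) ^ i.
  have hs : size (take i0 (l a)) <= d * dsize (ea a) ^ j.
    apply: leq_trans (hl a); rewrite dsize_enc_seq size_map.
    by rewrite size_take_min; lia.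
  have hx s : dsize (enc_seq (map (@el a) (take i0 s))) <=
      dsize (enc_seq (map (@el a) s)).
    by elim: s i0 {hs} => [|x s IH] [|i0] //=; have := IH i0; lia.
  have {}hx := leq_trans (hx (l a)) (hl a).
  have : dsize (enc_seq (catrev [seq f a x | x <- take i0 (l a) & b a x] (r a)))
      <= dsize (enc_seq (r a)) + size (take i0 (l a)) * F.
    elim: (take _ _) hx (r a) => [|x s IH] /= hx t; first by rewrite addn0.
    have {}IH := IH (leq_trans _ hx).
    case: ifP => _ /=; last by apply: leq_trans (IH _ t) _; [lia | rewrite mulSn; lia].
    apply: leq_trans (IH _ _) _; first lia.
    have : dsize (f a x) < F.
      rewrite /F add1n ltnS; apply: leq_trans (hf (existT _ a x)) _.
      apply: leq_exp; rewrite /ext /=; lia.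
    by rewrite /= mulSn; lia.
  move/leq_trans; apply; rewrite /P leq_add ?hr //.
  exact: leq_mul.
Qed.

End Comprehension.

Lemma ptime_rev A (ea : A -> data) (s : A -> seq data) :
  ptime ea (fun a => enc_seq (s a)) -> ptime ea (fun a => enc_seq (rev (s a))).
Proof.
move=> H.
have := @ptime_compr_catrev A (fun=> data) ea (fun a => id) s _
  (fun=> predT) (fun=> id) (fun=> [::]).
move=> K; apply: ptime_eq (K _ (ptime_nil _) (ptime_const _ _) (ptime_var _ _)) _.
  by apply: ptime_eq H _ => a; rewrite map_id.
by move=> a; rewrite filter_predT map_id.
Qed.

Lemma ptime_compr A (T : A -> Type) (ea : A -> data)
    (el : forall a, T a -> data) (l : forall a, seq (T a))
    (b : forall a, T a -> bool) (f : forall a, T a -> data) :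
  ptime ea (fun a => enc_seq [seq el a x | x <- l a]) ->
  ptime (ext ea el) (fun p => enc_bool (b (tag p) (tagged p))) ->
  ptime (ext ea el) (fun p => f (tag p) (tagged p)) ->
  ptime ea (fun a => enc_seq [seq f a x | x <- l a & b a x]).
Proof.
move=> Hl Hb Hf.
have := ptime_rev (ptime_compr_catrev Hl (r := fun=> [::]) (ptime_nil _) Hb Hf).
by move/ptime_eq; apply=> a; rewrite -[catrev _ _]/(rev _) revK.
Qed.

Lemma ptime_map A (T : A -> Type) (ea : A -> data)
    (el : forall a, T a -> data) (l : forall a, seq (T a))
    (f : forall a, T a -> data) :
  ptime ea (fun a => enc_seq [seq el a x | x <- l a]) ->
  ptime (ext ea el) (fun p => f (tag p) (tagged p)) ->
  ptime ea (fun a => enc_seq [seq f a x | x <- l a]).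
Proof.
move=> Hl Hf.
have := ptime_compr (b := fun=> xpredT) Hl (ptime_const _ (enc_bool true)) Hf.
by move/ptime_eq; apply=> a; rewrite filter_predT.
Qed.

Lemma ptime_cat A (ea : A -> data) (s t : A -> seq data) :
  ptime ea (fun a => enc_seq (s a)) -> ptime ea (fun a => enc_seq (t a)) ->
  ptime ea (fun a => enc_seq (s a ++ t a)).
Proof.
move=> Hs Ht.
have := @ptime_compr_catrev A (fun=> data) ea (fun a => id) (fun a => rev (s a))
  _ (fun=> predT) (fun=> id) t.
move=> K; apply: ptime_eq (K _ Ht (ptime_const _ _) (ptime_var _ _)) _.
  by apply: ptime_eq (ptime_rev Hs) _ => a; rewrite map_id.
by move=> a; rewrite filter_predT map_id catrevE revK.
Qed.

Lemma ptime_filter A (T : A -> Type) (ea : A -> data)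
    (el : forall a, T a -> data) (l : forall a, seq (T a))
    (b : forall a, T a -> bool) :
  ptime ea (fun a => enc_seq [seq el a x | x <- l a]) ->
  ptime (ext ea el) (fun p => enc_bool (b (tag p) (tagged p))) ->
  ptime ea (fun a => enc_seq [seq el a x | x <- l a & b a x]).
Proof. by move=> Hl Hb; apply: ptime_compr Hl Hb (ptime_var _ _). Qed.

(** Decided by whether the list of counterexamples is empty. *)
Lemma ptime_all A (T : A -> Type) (ea : A -> data)
    (el : forall a, T a -> data) (l : forall a, seq (T a))
    (b : forall a, T a -> bool) :
  ptime ea (fun a => enc_seq [seq el a x | x <- l a]) ->
  ptime (ext ea el) (fun p => enc_bool (b (tag p) (tagged p))) ->
  ptime ea (fun a => enc_bool (all (b a) (l a))).
Proof.
move=> Hl Hb; have Hf := ptime_filter (b := fun a x => ~~ b a x) Hl (ptime_neg Hb).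
have := ptime_ifd Hf (ptime_const _ (enc_bool false)) (ptime_const _ (enc_bool true)).
move/ptime_eq; apply=> a; elim: (l a) => //= x s IH; by case: (b a x).
Qed.

Lemma ptime_iter_tl A (ea da : A -> data) (k : A -> nat) :
  ptime ea da -> ptime ea (fun a => enc_unary (k a)) ->
  ptime ea (fun a => iter (k a) tl (da a)).
Proof.
move=> Hd Hk; have [c [e h]] := ptime_dsize Hd.
have iterE d n : foldl (fun d (x : data) => tl d) d (nseq n Nil) = iter n tl d.
  by elim: n d => //= n IH d; rewrite IH -iterSr.
suff: ptime ea (fun a => foldl (fun d (x : data) => tl d) (da a) (nseq (k a) Nil)).
  by move/ptime_eq; apply=> a; rewrite iterE.
apply: (@ptime_fold A (fun=> data) ea da (fun=> id) (fun a => nseq (k a) Nil)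
  (fun a x => tl) (fun s => c * s ^ e)) => //.
- by apply: ptime_eq Hk _ => a; rewrite map_id.
- set e' := fun p : _ * _ => _.
  by apply: ptime_tl; exact: (ptime_tl (ptime_id e')).
- by poly_bound.
move=> a i; apply: leq_trans (h a).
elim: (take _ _) (da a) => //= _ s IH d.
exact: leq_trans (IH _) (dsize_tl d).
Qed.

Lemma ptime_nth A (ea : A -> data) (s : A -> seq data) (k : A -> nat) :
  ptime ea (fun a => enc_seq (s a)) -> ptime ea (fun a => enc_unary (k a)) ->
  ptime ea (fun a => nth Nil (s a) (k a)).
Proof.
move=> Hs Hk; apply: ptime_eq (ptime_hd (ptime_iter_tl Hs Hk)) _ => a.
elim: (k a) (s a) => [|n IH] [|x t] //; last by rewrite iterSr /= IH.
by rewrite iterSr -[tl _]/(enc_seq [::]) IH nth_nil.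
Qed.

Lemma ptime_leq A (ea : A -> data) (i j : A -> nat) :
  ptime ea (fun a => enc_unary (i a)) -> ptime ea (fun a => enc_unary (j a)) ->
  ptime ea (fun a => enc_bool (i a <= j a)).
Proof.
move=> Hi Hj.
have := ptime_ifd (ptime_iter_tl Hi Hj) (ptime_const _ (enc_bool false))
  (ptime_const _ (enc_bool true)).
move/ptime_eq; apply=> a; have -> : iter (j a) tl (enc_unary (i a)) =
    enc_unary (i a - j a).
  elim: (j a) => [|n IH]; first by rewrite subn0.
  by rewrite iterS IH subnS; case: (_ - _).
by rewrite -subn_eq0; case: (_ - _).
Qed.

Lemma ptime_unary_size A (T : A -> Type) (ea : A -> data)
    (el : forall a, T a -> data) (l : forall a, seq (T a)) :
  ptime ea (fun a => enc_seq [seq el a x | x <- l a]) ->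
  ptime ea (fun a => enc_unary (size (l a))).
Proof.
move=> H; apply: ptime_eq (ptime_map (f := fun=> fun=> Nil) H (ptime_nil _)) _ => a.
by rewrite /enc_unary; congr enc_seq; elim: (l a) => //= x s ->.
Qed.

Definition enc_ord n (i : 'I_n) : data := enc_unary i.

Lemma ptime_enum_ord A (ea : A -> data) (n : A -> nat) :
  ptime ea (fun a => enc_unary (n a)) ->
  ptime ea (fun a => enc_seq [seq enc_ord i | i <- enum 'I_(n a)]).
Proof.
move=> Hn; have [c [e h]] := ptime_dsize Hn.
(* The state is a counter, initially [n], with the list built so far. Each round decrements the
   counter and pushes it, which ends in increasing order at 0. *)
pose g (x d : data) := Cons (tl (hd d)) (Cons (tl (hd d)) (tl d)).
have gE k m s : foldl (fun d x => g x d)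
    (Cons (enc_unary (k + m)) (enc_seq s)) (nseq k Nil) =
    Cons (enc_unary m) (enc_seq (map enc_unary (iota m k) ++ s)).
  elim: k s => // k IH s.
  have -> : iota m k.+1 = iota m k ++ [:: k + m] by rewrite -addn1 iotaD addnC.
  rewrite map_cat -catA; exact: (IH (enc_unary (k + m) :: s)).
suff H : ptime ea (fun a => foldl (fun d x => g x d) (Cons (enc_unary (n a)) Nil)
    (nseq (n a) Nil)).
  apply: ptime_eq (ptime_tl H) _ => a.
  have := gE (n a) 0 [::]; rewrite addn0 => -> /=; rewrite cats0.
  by rewrite -val_enum_ord -map_comp.
apply: (@ptime_fold A (fun=> data) ea _ (fun=> id) (fun a => nseq (n a) Nil)
  (fun a => g) (fun s => 2 + c * s ^ e + c * s ^ e * (2 + c * s ^ e))).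
- by apply: ptime_eq Hn _ => a; rewrite map_id.
- exact: ptime_cons Hn (ptime_nil _).
- set e' := fun p : _ * _ => _.
  have H : ptime e' (fun p => p.2) by exact: (ptime_tl (ptime_id e')).
  have H1 := ptime_tl (ptime_hd H).
  exact: (ptime_cons H1 (ptime_cons H1 (ptime_tl H))).
- by poly_bound.
move=> a i; set B := c * _.
have hB : dsize (enc_unary (n a)) <= B := h a.
have hn : n a <= B.
  by move: hB; rewrite dsize_enc_seq size_nseq; lia.
have : size (take i (nseq (n a) Nil)) <= n a.
  by rewrite size_take_min size_nseq geq_minr.
move: (take _ _) => s hs.
suff H u v : dsize u <= B -> dsize (foldl (fun d x => g x d) (Cons u v) s) <=
    1 + B + dsize v + size s * (1 + B).
  have := H _ Nil hB => /=.
  have : size s * (1 + B) <= B * (2 + B) by apply: leq_mul; lia.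
  lia.
elim: s {hs} u v => [|x s IH] u v hu /=; first lia.
have hu' : dsize (tl u) <= B by apply: leq_trans (dsize_tl u) hu.
apply: leq_trans (IH _ _ hu') _; rewrite /= mulSn; lia.
Qed.

(** * The greedy decision tree *)

(** Either outcome suffices for upper bounds on the cost; lower bounds use the exact value from
    [cost_edge]. *)
Lemma cost_edges n m (c : seq ({set 'I_n} * dtree n m)) h :
  (foldr (fun (e : {set 'I_n} * dtree n m) k =>
     if h \in e.1 then cost e.2 h else k) 0 c = 0) \/
  (exists P D, [/\ List.In (P, D) c, h \in P &
   foldr (fun (e : {set 'I_n} * dtree n m) k =>
     if h \in e.1 then cost e.2 h else k) 0 c = cost D h]).
Proof.
elim: c => [|[P D] c IH] /=; first by left.
case: ifP => hP; first by right; exists P, D; split=> //; left.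
by case: IH => [|[P' [D' [? ? ?]]]]; [left | right; exists P', D'; split=> //; right].
Qed.

Section Instance.
Variable I : pcwcdt.
Local Notation hyp := 'I_(dt_n I).
Local Notation test := 'I_(dt_m I).
Implicit Types (X Y P : {set hyp}) (Q path : {set test}) (h : hyp) (s t : test).

Definition reply t h : {set hyp} := pblock (dt_test t) h.

Lemma reply_cover t h : h \in cover (dt_test t).
Proof. by rewrite (cover_partition (dt_test_partition t)) inE. Qed.

Lemma reply_triv t : trivIset (dt_test t).
Proof. by case/and3P: (dt_test_partition t). Qed.

Lemma mem_reply t h : h \in reply t h.
Proof. by rewrite mem_pblock reply_cover. Qed.

Lemma reply_mem t h : reply t h \in dt_test t.
Proof. exact: pblock_mem (reply_cover t h). Qed.

Lemma reply_def t P h : P \in dt_test t -> h \in P -> reply t h = P.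
Proof. exact: def_pblock (reply_triv t). Qed.

Lemma reply_same t h h' : h' \in reply t h -> reply t h' = reply t h.
Proof. exact: reply_def (reply_mem t h). Qed.

(** A comparison of two cardinals, which a program decides by one comparison of unary numbers. *)
Definition light X t h : bool := #|X :&: reply t h| <= #|X :\: reply t h|.

Lemma lightE X t h : light X t h = (2 * #|X :&: reply t h| <= #|X|).
Proof. by rewrite /light -(cardsID (reply t h) X); lia. Qed.

(** Distinct parts are disjoint. The other part lies in the complement of the heavy one, which is
    smaller than the heavy part, which in turn lies in the complement of the other. *)
Lemma light_other X t h h' : ~~ light X t h -> h' \notin reply t h -> light X t h'.
Proof.
move=> hl hn; rewrite -ltnNge in hl.
have dis x : x \in reply t h -> x \notin reply t h'.
  move=> /reply_same E; apply: contra hn => /reply_same E'.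
  by rewrite -E E' mem_reply.
apply: leq_trans (leq_trans (ltnW hl) _); apply/subset_leq_card/subsetP => x;
  rewrite !inE => /andP[-> xh]; rewrite andbT; last exact: dis.
by apply: contraL xh; exact: dis.
Qed.

(** What remains of [X] once the tests of [Q] have been performed with target [h]. *)
Definition class X Q h : {set hyp} :=
  [set h' in X | [forall t in Q, h' \in reply t h]].

Lemma class0 X h : class X set0 h = X.
Proof.
apply/setP => x; rewrite inE; case: (x \in X) => //=.
by apply/forall_inP => t; rewrite inE.
Qed.

Lemma mem_class X Q h : h \in X -> h \in class X Q h.
Proof. by move=> hX; rewrite inE hX; apply/forall_inP => t _; exact: mem_reply. Qed.

Definition downset Q : Prop := forall s t, t \in Q -> dt_prec s t -> s \in Q.

Variable phase : {set hyp} -> {set test}.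

(** An empty set of pending tests signals that a phase is over and the next one starts. *)
Definition pending X Q : {set test} := if Q == set0 then phase X else Q.

(** By antisymmetry [dt_prec t s] stands for [s = t]. As a comprehension over an enumeration the
    definition is directly executable by [ptime_filter]. *)
Definition minimal Q : seq test :=
  [seq t <- enum 'I_(dt_m I) | (t \in Q) &&
    all (fun s => (s \in Q) && dt_prec s t ==> dt_prec t s) (enum 'I_(dt_m I))].

(** Instances list no parts, only equivalence matrices, so a part that meets [X] is named by its
    least element in [X]. *)
Definition reps X t : seq hyp :=
  [seq h <- enum 'I_(dt_n I) | (h \in X) &&
    all (fun h' => (h' \in X) && (h' \in reply t h) ==> (h <= h'))
      (enum 'I_(dt_n I))].

Definition pick_hyp X : hyp :=
  head (Ordinal (dt_n_gt0 I)) [seq h <- enum 'I_(dt_n I) | h \in X].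

(** Running out of fuel, or of pending tests, yields a default leaf; under [fuel_inv] and progress
    of the phases neither happens. *)
Fixpoint build k X Q : dtree (dt_n I) (dt_m I) :=
  if k is k'.+1 then
    if #|X| <= 1 then Leaf _ (pick_hyp X) else
    if minimal (pending X Q) is t :: _ then
      Node t [seq (reply t h, build k' (X :&: reply t h) (pending X Q :\ t))
             | h <- reps X t]
    else Leaf _ (pick_hyp X)
  else Leaf _ (pick_hyp X).

Lemma mem_reps X t h : reflect
  (h \in X /\ forall h', h' \in X -> h' \in reply t h -> h <= h')
  (h \in reps X t).
Proof.
rewrite mem_filter mem_enum inE andbT.
apply: (iffP andP) => [[hX /allP H]|[hX H]]; split=> //.
  by move=> h' h'X h'h; have := H h'; rewrite mem_enum h'X h'h; exact.
by apply/allP => h' _; apply/implyP => /andP[]; exact: H.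
Qed.

Lemma reps_uniq X t : uniq [seq reply t h | h <- reps X t].
Proof.
rewrite map_inj_in_uniq => [|h h']; first exact/filter_uniq/enum_uniq.
case/mem_reps=> hX H /mem_reps[h'X H'] E.
apply/val_inj/eqP; rewrite eqn_leq H ?H' //; first by rewrite -E mem_reply.
by rewrite E mem_reply.
Qed.

Lemma reps_surj X t h : h \in X -> exists2 h', h' \in reps X t & reply t h' = reply t h.
Proof.
move=> hX; pose p := [pred x | (x \in X) && (x \in reply t h)].
have ph : p h by rewrite /= hX mem_reply.
case: (arg_minnP val ph) => x /andP[xX xh] xmin; exists x; last exact: reply_same.
apply/mem_reps; split=> // y yX; rewrite (reply_same xh) => yh.
by apply: xmin; rewrite /= yX.
Qed.

(** Keeps the total work over sibling nodes linear in [X]: the parts named by the representatives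
    are disjoint. *)
Lemma reps_card X t : \sum_(h <- reps X t) #|X :&: reply t h| <= #|X|.
Proof.
rewrite -(big_map (reply t) xpredT (fun P => #|X :&: P|)) big_uniq ?reps_uniq //=.
set r := [seq _ | _ <- _].
have E P : #|X :&: P| = \sum_(x in X | x \in P) 1.
  by rewrite -sum1_card; apply: eq_bigl => x; rewrite inE.
under eq_bigr do rewrite E.
(* Each [x] of [X] is counted by the single part [reply t x], if at all. *)
rewrite (exchange_big_dep (mem X)) //=; last by move=> P x _ /andP[].
rewrite -sum1_card; apply: leq_sum => x xX.
rewrite (eq_bigl (fun P => (P \in r) && (x \in P))); last first.
  by move=> P; rewrite xX.
rewrite -[leqRHS](big_pred1_eq addn (reply t x) (fun=> 1)) /=.
rewrite [leqLHS]big_mkcond [leqRHS]big_mkcond; apply: leq_sum => P _.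
case: ifP => // /andP[/mapP[h _ ->] xh].
by rewrite (reply_same xh) eqxx.
Qed.

Lemma minimal_mem Q t r : minimal Q = t :: r ->
  t \in Q /\ forall s, s \in Q -> dt_prec s t -> s = t.
Proof.
move=> E; have : t \in minimal Q by rewrite E mem_head.
rewrite mem_filter => /andP[/andP[tQ /allP H] _]; split=> // s sQ st.
have [_ anti _] := dt_prec_order I; apply: anti; rewrite st /=.
by have := H s; rewrite mem_enum sQ st; exact.
Qed.

Lemma minimal_cons Q : Q != set0 -> exists t r, minimal Q = t :: r.
Proof.
case/set0Pn=> t0 t0Q; have [refl anti trans] := dt_prec_order I.
(* A test with the fewest predecessors in [Q] is minimal: by transitivity a strict predecessor would
   have fewer, since it does not count the test itself. *)
pose below t := #|[set s in Q | dt_prec s t]|.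
case: (@arg_minnP _ _ (fun t => t \in Q) below t0Q) => t tQ tmin.
suff: t \in minimal Q by case: (minimal Q) => // u r; exists u, r.
rewrite mem_filter mem_enum inE andbT; apply/andP; split => //.
apply/allP => s _; apply/implyP => /andP[sQ st].
apply/contraT => nts; have := tmin s sQ; rewrite leqNgt => /negP[].
apply: proper_card; apply/properP; split.
  by apply/subsetP => x; rewrite !inE => /andP[-> /trans]; apply.
by exists t; rewrite !inE tQ ?refl // negb_and nts orbT.
Qed.

(** * Correctness and depth of the greedy tree *)

Section Correct.
Variables (R : realType) (q A : R).
Hypotheses (q_gt1 : (1 < q)%R) (A_ge0 : (0 <= A)%R).
Hypothesis phase_down : forall X, 1 < #|X| -> downset (phase X).
Hypothesis phase_card : forall X, 1 < #|X| -> (#|phase X|%:R <= A)%R.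
Hypothesis phase_class : forall X h, 1 < #|X| -> h \in X ->
  (q * #|class X (phase X) h|%:R <= #|X|%:R)%R.

(* [M] bounds what is left of [X] once the tests of [Q] have been performed. It
   drops in every phase, which pays for the at most [m] new pending tests. *)
Definition fuel_inv k X Q M : Prop :=
  [/\ X != set0, forall h, h \in X -> #|class X Q h| <= M
    & (dt_m I).+1 * M + #|Q| <= k].

(** The tests still to be paid for: the pending ones, then log_q [M] phases of at most [A] tests
    each. *)
Definition bound Q M : R := (#|Q|%:R + A * (ln M%:R / ln q))%R.

Lemma fuel_inv_gt0 k X Q M : fuel_inv k X Q M -> 0 < M.
Proof.
case=> /set0Pn[h hX] H _; apply: leq_trans (H _ hX); rewrite card_gt0.
by apply/set0Pn; exists h; exact: mem_class.
Qed.

Lemma bound_ge Q M : 0 < M -> (#|Q|%:R <= bound Q M)%R.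
Proof.
move=> M0; rewrite /bound lerDl mulr_ge0 // divr_ge0 ?ln_ge0 ?ler1n //.
exact: ltW.
Qed.

(** A new phase replaces [M] by some [M'] with q [M'] <= |X| <= [M]. The logarithm to base [q] drops
    by at least one, which releases [A] and so pays for the new pending tests. *)
Lemma pending_inv k X Q M : 1 < #|X| -> fuel_inv k X Q M ->
  exists M', [/\ fuel_inv k X (pending X Q) M', pending X Q != set0
    & (bound (pending X Q) M' <= bound Q M)%R].
Proof.
move=> X1 inv; have M0 := fuel_inv_gt0 inv; have [X0 cM kM] := inv.
rewrite /pending; case: eqVneq => [Q0|Q0]; last by exists M.
have q0 : (0 < q)%R by exact: lt_trans q_gt1.
have XM : #|X| <= M by case/set0Pn: X0 => h /cM; rewrite Q0 class0.
have [h0 h0X] := set0Pn _ X0.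
pose M' := \max_(h in X) #|class X (phase X) h|.
have cM' h : h \in X -> #|class X (phase X) h| <= M'.
  by move=> hX; rewrite /M' (bigD1 h) //= leq_maxl.
have qM' : (q * M'%:R <= #|X|%:R)%R.
  rewrite /M'.
  have /(eq_bigmax_cond (fun h => #|class X (phase X) h|))[h hX ->] : 0 < #|X|.
    by rewrite card_gt0.
  exact: phase_class.
have M'0 : 0 < M'.
  apply: leq_trans (cM' _ h0X); rewrite card_gt0.
  by apply/set0Pn; exists h0; exact: mem_class.
have M'X : M' < #|X|.
  rewrite -(ltr_nat R); apply: lt_le_trans qM'.
  by rewrite ltr_pMl // ltr0n.
exists M'; split.
- split=> //; apply: leq_trans kM; rewrite Q0 cards0 addn0.
  have : #|phase X| <= dt_m I by rewrite -[leqRHS]card_ord max_card.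
  have : (dt_m I).+1 * M'.+1 <= (dt_m I).+1 * M by rewrite leq_mul2l; lia.
  by rewrite mulnS; lia.
(* A phase without tests would leave the class equal to [X], against [M'] < |X|. *)
- apply/eqP => E; have := cM' _ h0X; rewrite E class0; lia.
rewrite /bound Q0 cards0 add0r.
have lnq : (0 < ln q)%R by exact: ln_gt0.
have h1 : (ln q + ln M'%:R <= ln M%:R)%R.
  rewrite -lnM ?posrE ?ltr0n //; rewrite ler_ln ?posrE ?mulr_gt0 ?ltr0n //.
  by apply: le_trans qM' _; rewrite ler_nat.
have h2 : (1 + ln M'%:R / ln q <= ln M%:R / ln q)%R.
  by rewrite -[X in (X + _)%R](divff (lt0r_neq0 lnq)) -mulrDl ler_pM2r ?invr_gt0.
have h3 := phase_card X1.
have := ler_wpM2l A_ge0 h2; rewrite mulrDr mulr1; lra.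
Qed.

(** The condition imposed by [t] moves from the class into the hypothesis set, so [M] stays valid,
    and the test that leaves [Q] accounts for the unit of fuel spent. *)
Lemma child_inv k X Q M t h : fuel_inv k.+1 X Q M -> t \in Q -> h \in X ->
  fuel_inv k (X :&: reply t h) (Q :\ t) M.
Proof.
move=> [_ cM kM] tQ hX; split.
- by apply/set0Pn; exists h; rewrite inE hX mem_reply.
- move=> h' /setIP[h'X h'h]; apply: leq_trans (cM _ h'X).
  apply/subset_leq_card/subsetP => x; rewrite !inE -andbA => /and3P[-> xh /forall_inP H].
  apply/forall_inP => s sQ; case: (eqVneq s t) => [->|st].
    by rewrite (reply_same h'h).
  by apply: H; rewrite !inE st.
- by have := cardsD1 t Q; rewrite tQ add1n => E; move: kM; rewrite E addnS ltnS.
Qed.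

Lemma pick_hyp1 X : X != set0 -> #|X| <= 1 -> X = [set pick_hyp X].
Proof.
move=> X0 X1; have /cards1P[h E] : #|X| == 1 by rewrite eqn_leq X1 card_gt0.
rewrite /pick_hyp; set s := [seq _ <- _ | _].
have : h \in s by rewrite mem_filter E set11 mem_enum.
have : all (mem X) s by apply: filter_all.
by case: s => //= x s /andP[]; rewrite {1}E => /set1P -> _ _.
Qed.

(** All predecessors of pending tests are pending or on the path already. A minimal pending test
    thus has its strict predecessors on the path, and performing it preserves the invariant. *)
Lemma build_correct k X Q M path :
  fuel_inv k X Q M ->
  (forall s t, t \in Q -> dt_prec s t -> s \in Q \/ s \in path) ->
  [/\ identifies X (build k X Q), dt_closed path (build k X Q)
    & forall h, h \in X -> ((cost (build k X Q) h)%:R <= bound Q M)%R].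
Proof.
elim: k X Q M path => [|k IH] X Q M path inv prec.
  by have [_ _] := inv; have := fuel_inv_gt0 inv; lia.
rewrite /=; case: leqP => [X1|X1].
  split=> //=; first by apply/eqP/pick_hyp1 => //; case: inv.
  by move=> h _; apply: le_trans (bound_ge _ (fuel_inv_gt0 inv)).
have [M' [inv' Q0 leB]] := pending_inv X1 inv.
have {}prec : forall s t, t \in pending X Q -> dt_prec s t ->
    s \in pending X Q \/ s \in path.
  move=> s t; rewrite /pending; case: eqP => [_ tP st|_]; last exact: prec.
  by left; apply: phase_down tP st.
have [t [r E]] := minimal_cons Q0; rewrite E.
have [tQ tmin] := minimal_mem E.
have precD s u : u \in pending X Q :\ t -> dt_prec s u ->
    s \in pending X Q :\ t \/ s \in t |: path.
  rewrite !inE => /andP[_ uQ] su; case: eqP => [_|_]; first by right.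
  by case: (prec _ _ uQ su) => ->; [left | right].
have {}IH h (hX : h \in X) := IH _ _ _ (t |: path) (child_inv inv' tQ hX) precD.
split.
- rewrite /= -map_comp -[map _ (reps X t)]/([seq reply t h | h <- reps X t]).
  rewrite reps_uniq /=; apply/andP; split.
    apply/eqP/setP => P; rewrite !inE; apply/mapP/andP.
      move=> [h /mem_reps[hX _] ->]; split; first exact: reply_mem.
      by apply/set0Pn; exists h; rewrite inE mem_reply.
    move=> [Pt /set0Pn[h /setIP[hP hX]]].
    have [h' h'r E'] := reps_surj t hX; exists h' => //.
    by rewrite E' (reply_def Pt hP).
  rewrite all_map; apply/allP => h /mem_reps[hX _] /=.
  by rewrite setIC; have [] := IH h hX.
- rewrite /=; apply/andP; split.
    apply/forallP => s; apply/implyP => /andP[st sNt].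
    case: (prec _ _ tQ st) => // sQ; move: sNt.
    by rewrite (tmin _ sQ st) eqxx.
  rewrite all_map; apply/allP => h /mem_reps[hX _] /=.
  by have [] := IH h hX.
move=> h hX /=.
have M'0 := fuel_inv_gt0 inv'.
set c := [seq _ | _ <- _].
apply: le_trans leB.
case: (cost_edges c h) => [->|[P [D [/List.in_map_iff[h' [[<- <-] h'r]] hP ->]]]].
  apply: le_trans (bound_ge _ M'0).
  by rewrite ler1n card_gt0.
have /mem_reps[h'X _] : h' \in reps X t.
  elim: (reps X t) h'r => //= x s IHs [->|/IHs]; rewrite inE ?eqxx //.
  by move->; rewrite orbT.
have [_ _ /(_ h)] := IH h' h'X; rewrite inE hX hP => /(_ isT).
rewrite /bound -addn1 natrD (cardsD1 t (pending X Q)) tQ natrD /=; lra.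
Qed.

End Correct.
End Instance.

(** * The residual set cover instance *)

(** Subtrees occur inside a list of edges, so the induction hypothesis has to range over the members
    of that list. *)
Lemma dtree_nested_ind n m (P : dtree n m -> Prop) :
  (forall h, P (Leaf m h)) ->
  (forall t c, (forall e, List.In e c -> P e.2) -> P (Node t c)) ->
  forall D, P D.
Proof.
move=> PL PN; fix IH 1 => -[h|t c]; first exact: PL.
apply: PN; elim: c => [|e c IHc] e' /=; first by case.
by case=> [<-|]; [exact: IH | exact: IHc].
Qed.

Lemma all_In T (p : pred T) s x : all p s -> List.In x s -> p x.
Proof. by elim: s => //= y s IH /andP[py /IH {}IH] [<-|]. Qed.

Lemma In_map_fst (T : eqType) U (s : seq (T * U)) x :
  x \in [seq e.1 | e <- s] -> exists y, List.In (x, y) s.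
Proof.
elim: s => //= -[a b] s IH; rewrite inE => /predU1P[->|/IH[y sy]].
  by exists b; left.
by exists y; right.
Qed.

Lemma In_map_fst_mem (T : eqType) U (s : seq (T * U)) e :
  List.In e s -> e.1 \in [seq e.1 | e <- s].
Proof.
by elim: s => //= a s IH [->|/IH]; rewrite inE ?eqxx // => ->; rewrite orbT.
Qed.

Lemma cost_edge n m (c : seq ({set 'I_n} * dtree n m)) P D h :
  uniq [seq e.1 | e <- c] -> List.In (P, D) c -> h \in P ->
  (forall e, List.In e c -> h \in e.1 -> e.1 = P) ->
  foldr (fun (e : {set 'I_n} * dtree n m) k =>
    if h \in e.1 then cost e.2 h else k) 0 c = cost D h.
Proof.
elim: c => //= -[P' D'] c IH /= /andP[P'c uc] inc hP one.
case: ifP => hP'; last first.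
  apply: IH => //; last by move=> e ec; apply: one; right.
  by case: inc => // -[E _]; rewrite E hP in hP'.
case: inc => [[_ ->] //|Pc]; move: P'c.
have /= -> := one _ (or_introl erefl) hP'.
by rewrite (In_map_fst_mem Pc).
Qed.

(** The guarantee on an approximate cover refers to a minimum, which must first be known to exist.
    Feasibility is a [Prop], so the least value is found classically. *)
Lemma is_min_exists T (P : T -> Prop) (f : T -> nat) y :
  P y -> exists2 k, is_min P f k & k <= f y.
Proof.
move=> Py; pose p k := `[< exists2 z, P z & f z = k >].
have ex : exists k, p k by exists (f y); apply/asboolP; exists y.
case: (ex_minnP ex) => k /asboolP pk kmin; exists k.
  by split=> // z Pz; apply: kmin; apply/asboolP; exists z.
by apply: kmin; apply/asboolP; exists y.
Qed.

Section Residual.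
Variables (I : pcwcdt) (X : {set 'I_(dt_n I)}).
Local Notation hyp := 'I_(dt_n I).
Local Notation test := 'I_(dt_m I).
Local Notation item := 'I_#|X|.

(* At one hypothesis of [X] there may be no light test, so the tests need not
   cover [X]. The index [ord0] stands for an extra set covering everything; as
   every test precedes it, a closed family using it contains all tests. *)
Definition residual_set (i : 'I_(dt_m I).+1) : {set item} :=
  if unlift ord0 i is Some t then [set j | light X t (enum_val j)] else setT.

Definition residual_prec : rel 'I_(dt_m I).+1 := fun i j =>
  if unlift ord0 j is Some t then
    if unlift ord0 i is Some s then dt_prec s t else false
  else true.

Lemma residual_prec_order : partial_order residual_prec.
Proof.
have [refl anti trans] := dt_prec_order I; split.
- by move=> i; rewrite /residual_prec; case: unliftP.
- move=> i j; rewrite /residual_prec.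
  by case: unliftP => [t|] ->; case: unliftP => [s|] -> //= /anti ->.
- move=> j i k; rewrite /residual_prec.
  case: (unliftP _ k) => [t|] _ //; case: (unliftP _ j) => [s|] _ //.
  by case: (unliftP _ i) => [u|] _ //; exact: trans.
Qed.

Lemma residual_cover : \bigcup_i residual_set i = [set: item].
Proof.
apply/setP => j; rewrite inE; apply/bigcupP; exists ord0 => //.
by rewrite /residual_set unlift_none inE.
Qed.

Lemma half_bounds : (0 < (2%:R : rat)^-1 <= 1)%R.
Proof. by []. Qed.

Definition residual : pcsc :=
  Pcsc residual_prec_order residual_cover half_bounds.

Lemma ratr_residual (R : realType) : ratr (sc_f residual) = (2^-1)%R :> R.
Proof. by rewrite /sc_f /residual fmorphV rmorph_nat. Qed.

Definition lit (T : {set test}) : {set hyp} :=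
  [set h in X | [exists t in T, light X t h]].

Lemma lit_sub (T T' : {set test}) : T \subset T' -> lit T \subset lit T'.
Proof.
move=> /subsetP TT; apply/subsetP => h; rewrite !inE => /andP[-> /exists_inP[t tT ht]].
by apply/exists_inP; exists t => //; exact: TT.
Qed.

Lemma cov_residual (C : {set 'I_(dt_m I).+1}) : ord0 \notin C ->
  #|@cov residual C| = #|lit [set t | lift ord0 t \in C]|.
Proof.
move=> C0; rewrite -(card_imset _ (@enum_val_inj _ X)); apply: eq_card => h.
apply/imsetP/idP => [[j /bigcupP[i iC]]|].
  rewrite /= /residual_set; case: unliftP iC => [t|] -> iC; last by rewrite iC in C0.
  rewrite inE => jt ->; rewrite inE enum_valP; apply/exists_inP.
  by exists t => //; rewrite inE.
rewrite inE => /andP[hX /exists_inP[t]]; rewrite inE => tC ht.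
exists (enum_rank_in hX h); last by rewrite enum_rankK_in.
apply/bigcupP; exists (lift ord0 t) => //=.
by rewrite /residual_set liftK inE enum_rankK_in.
Qed.

(** [Y] shrinks along the path while lightness refers to the fixed [X]. At a leaf [Y] is a single
    hypothesis, the one element that may stay unlit. The set [T] is closed up to the tests already
    on [path]. *)
Lemma light_path D Y path :
  identifies Y D -> dt_closed path D -> Y != set0 ->
  exists (T : {set test}) h, [/\ h \in Y, #|T| <= cost D h,
    (forall s t, t \in T -> dt_prec s t -> s \in T \/ s \in path)
    & #|(X :&: Y) :\: lit T| <= 1].
Proof.
elim/(@dtree_nested_ind (dt_n I) (dt_m I)): D Y path => [h|t c IH] Y path.
  move=> /eqP -> _ _; exists set0, h; rewrite set11 cards0; split=> //.
    by move=> s t; rewrite inE.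
  rewrite -(cards1 h); apply/subset_leq_card/subsetP => x.
  by rewrite !inE => /andP[_ /andP[]].
move=> /= /and3P[uc /eqP /setP labels idc] /andP[/forallP prec clc] Y0.
have step (T : {set test}) :
    (forall s u, u \in T -> dt_prec s u -> s \in T \/ s \in t |: path) ->
    forall s u, u \in t |: T -> dt_prec s u -> s \in t |: T \/ s \in path.
  move=> hT s u; rewrite !inE => /predU1P[->|uT] su.
    case: (eqVneq s t) => [_|st]; first by left.
    by right; have /implyP := prec s; rewrite su st; exact.
  case: (hT s u uT su); rewrite ?inE; first by move=> ->; rewrite orbT; left.
  by case/orP => ->; [left | right].
have [/existsP[P /andP[/setIP[Pt PY] Pheavy]]|/existsPn noP] := boolP
    [exists P, (P \in dt_test t :&: [set P | P :&: Y != set0]) &&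
      (#|X :\: P| < #|X :&: P|)].
  rewrite inE in PY.
  have /In_map_fst[D' Dc] : P \in [seq e.1 | e <- c].
    by have := labels P; rewrite !inE Pt PY.
  have [T [h [/setIP[hP hY] hT pT lT]]] :=
    IH _ Dc (P :&: Y) (t |: path) (all_In idc Dc) (all_In clc Dc) PY.
  exists (t |: T), h; split=> //.
  - rewrite (cost_edge uc Dc hP); last first.
      move=> e ec he; have := labels e.1; rewrite !inE (In_map_fst_mem ec).
      by case/esym/andP => et _; rewrite -(reply_def et he) (reply_def Pt hP).
    by rewrite cardsU1 -add1n leq_add ?leq_b1.
  - exact: step.
  apply: leq_trans lT; apply/subset_leq_card/subsetP => x.
  rewrite !inE => /andP[xl /andP[xX xY]]; rewrite xX xY /= !andbT in xl *.
  case: (boolP (x \in P)) => xP /=.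
    rewrite andbT; apply: contra xl => /exists_inP[s sT xs].
    by apply/exists_inP; exists s => //; rewrite inE sT orbT.
  (* Outside the heavy part [P] the test [t] itself is light. *)
  case/negP: xl; apply/exists_inP; exists t; first exact: setU11.
  have [h0 h0P] : exists h0, h0 \in P by exists h.
  apply: (@light_other _ _ _ h0); last by rewrite (reply_def Pt h0P).
  by rewrite /light (reply_def Pt h0P) -ltnNge.
(* No heavy part meets [Y], so [t] alone lights all of [X :&: Y], and every hypothesis of [Y] pays
   at least for [t]. *)
have [h hY] := set0Pn _ Y0; exists [set t], h; split=> //.
- by rewrite cards1.
- by move: (step set0); rewrite setU0; apply=> s u; rewrite inE.
rewrite -[#|_|]/(#|_|) (_ : _ :\: _ = set0) ?cards0 //.
apply/eqP; rewrite setD_eq0; apply/subsetP => x /setIP[xX xY].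
rewrite inE xX; apply/exists_inP; exists t; first exact: set11.
have := noP (reply t x); rewrite !inE reply_mem /=.
have -> /= : reply t x :&: Y != set0.
  by apply/set0Pn; exists x; rewrite inE mem_reply.
by rewrite -leqNgt.
Qed.

(** The path starts from all hypotheses, so the same [D] serves for every [X]. *)
Lemma light_downset D : @pc_dtree I D ->
  exists T : {set test}, [/\ downset T, #|T| <= cost_W D & #|X :\: lit T| <= 1].
Proof.
move=> [idD clD].
have [|T [h [_ hT pT lT]]] := light_path idD clD.
  by apply/set0Pn; exists (Ordinal (dt_n_gt0 I)); rewrite inE.
exists T; split; last by rewrite setIT in lT.
- by move=> s t tT st; case: (pT s t tT st) => //; rewrite inE.
- by apply: leq_trans hT _; rewrite /cost_W (bigD1 h) //= leq_maxl.
Qed.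

End Residual.

Lemma five_mul_sub1_gt0 (R : realFieldType) (b : R) :
  (1 <= b -> 0 < 5 * b - 1)%R.
Proof. lra. Qed.

Lemma shrink_half (R : realFieldType) (b c x : R) :
  (1 <= b -> 0 <= c -> 2 * c <= x -> 5 * b * c <= x * (5 * b - 1))%R.
Proof. nra. Qed.

(** The class misses the [l] lit elements, at least a fraction 1/(2b) of [x]; so [c] is at most (1 -
    1/(2b)) [x], and hence at most (1 - 1/(5b)) [x]. *)
Lemma shrink_cover (R : realFieldType) (b c l x : R) :
  (c + l <= x -> 1 <= b -> 0 <= x -> x <= 2 * b * l ->
   5 * b * c <= x * (5 * b - 1))%R.
Proof. nra. Qed.

(** * A phase obtained from an approximate cover *)

Section Phase.
Variables (R : realType) (alpha beta : R).
Hypotheses (alpha_ge1 : (1 <= alpha)%R) (beta_ge1 : (1 <= beta)%R).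
Variable cover : forall J : pcsc, {set 'I_(sc_m J)}.
Hypothesis coverP : forall J : pcsc,
  sc_feasible (ratr (sc_f J) / beta)%R (cover J) /\
  forall opt, is_min (@sc_feasible R J (ratr (sc_f J))) (fun C => #|C|) opt ->
    (#|cover J|%:R <= alpha * opt%:R)%R.
Variable I : pcwcdt.
Implicit Type X : {set 'I_(dt_n I)}.

Definition phase X : {set 'I_(dt_m I)} :=
  [set t | lift ord0 t \in cover (residual X)].

Lemma phase_down X : downset (phase X).
Proof.
move=> s t; rewrite !inE => tC st.
have [[closed _] _] := coverP (residual X).
by apply: closed tC _; rewrite /= /residual_prec !liftK.
Qed.

Lemma phase_card_cover X : #|phase X| <= #|cover (residual X)|.
Proof.
rewrite -(card_imset _ (@lift_inj _ ord0)); apply/subset_leq_card/subsetP => i.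
by case/imsetP => t; rewrite inE => tC ->.
Qed.

Lemma phase_card X D : 1 < #|X| -> @pc_dtree I D ->
  (#|phase X|%:R <= alpha * (cost_W D)%:R)%R.
Proof.
move=> X1 /(light_downset X)[T [dT cT lT]].
pose C := [set lift ord0 t | t in T].
have C0 : ord0 \notin C.
  by apply/imsetP => -[t _ /eqP]; rewrite (negbTE (neq_lift _ _)).
have TC : [set t | lift ord0 t \in C] = T.
  by apply/setP => t; rewrite inE mem_imset //; exact: lift_inj.
have feasC : @sc_feasible R (residual X) (ratr (sc_f (residual X))) C.
  split.
    move=> i j /imsetP[t tT ->]; rewrite /= /residual_prec liftK.
    case: unliftP => [s|] -> // st; apply: imset_f; exact: dT tT st.
  rewrite cov_residual // TC ratr_residual /=.
  (* All but one of at least two elements are at least half of them. *)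
  have : #|X| <= 2 * #|lit X T|.
    have E : X :&: lit X T = lit X T.
      by apply/setIidPr/subsetP => h; rewrite inE => /andP[].
    by have := cardsID (lit X T) X; rewrite E; lia.
  rewrite -(ler_nat R) natrM => h; lra.
have [k kmin kC] := is_min_exists (fun C : {set 'I_(sc_m (residual X))} => #|C|) feasC.
have [_ /(_ _ kmin) h] := coverP (residual X).
have : (#|phase X|%:R <= #|cover (residual X)|%:R :> R)%R.
  by rewrite ler_nat phase_card_cover.
move/le_trans; apply.
apply: le_trans h _; rewrite ler_wpM2l ?(le_trans _ alpha_ge1) ?ler_nat //.
apply: leq_trans kC _; rewrite card_imset //; exact: lift_inj.
Qed.

(** A cover that uses the extra set contains every test by closure, and all tests together light all
    of [X] but one element. Otherwise what it covers is exactly what its tests light. *)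
Lemma phase_lit X D : 1 < #|X| -> @pc_dtree I D ->
  (#|X|%:R <= 2 * beta * #|lit X (phase X)|%:R)%R.
Proof.
move=> X1 /(light_downset X)[T [_ _ lT]].
have [[closed feas] _] := coverP (residual X).
have b0 : (0 < beta)%R by apply: lt_le_trans beta_ge1.
case: (boolP (ord0 \in cover (residual X))) => C0.
  have -> : phase X = setT.
    apply/setP => t; rewrite !inE; apply: closed C0 _.
    by rewrite /= /residual_prec unlift_none.
  have : #|X| <= 2 * #|lit X setT|.
    have := subset_leq_card (lit_sub X (subsetT T)).
    have E : X :&: lit X T = lit X T.
      by apply/setIidPr/subsetP => h; rewrite inE => /andP[].
    by have := cardsID (lit X T) X; rewrite E; lia.
  rewrite -(ler_nat R) natrM => /le_trans; apply.
  by rewrite ler_wpM2r // -[leLHS]mulr1 ler_wpM2l.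
move: feas; rewrite cov_residual // -/(phase X) ratr_residual /=.
by rewrite -invfM ler_pdivrMl ?mulr_gt0.
Qed.

Lemma phase_class X h D : 1 < #|X| -> h \in X -> @pc_dtree I D ->
  (5 * beta / (5 * beta - 1) * #|class X (phase X) h|%:R <= #|X|%:R)%R.
Proof.
move=> X1 hX pD; have b1 : (0 < 5 * beta - 1)%R := five_mul_sub1_gt0 beta_ge1.
rewrite mulrAC ler_pdivrMr //.
have [/exists_inP[t tP ht]|noP] := boolP [exists t in phase X, light X t h].
  have : 2 * #|class X (phase X) h| <= #|X|.
    apply: leq_trans (_ : 2 * #|X :&: reply t h| <= _); last by rewrite -lightE.
    rewrite leq_mul2l; apply/subset_leq_card/subsetP => x.
    by rewrite !inE => /andP[-> /forall_inP]; apply.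
  by rewrite -(ler_nat R) natrM; exact: shrink_half.
(* The class and the lit elements are disjoint: members of the class give the same replies as [h],
   at which no test of the phase is light. *)
have : #|class X (phase X) h| + #|lit X (phase X)| <= #|X|.
  rewrite -cardsUI (_ : _ :&: _ = set0) ?cards0 ?addn0.
    by apply/subset_leq_card/subsetP => x; rewrite !inE => /orP[] /andP[].
  apply/eqP; rewrite setI_eq0 disjoints_subset; apply/subsetP => x.
  rewrite !inE => /andP[-> /forall_inP H] /=.
  apply: contra noP => /exists_inP[t tP xt]; apply/exists_inP; exists t => //.
  by move: xt; rewrite /light (reply_same (H t tP)).
by rewrite -(ler_nat R) natrD => /shrink_cover; apply=> //; exact: phase_lit pD.
Qed.

End Phase.

(** * Programs on encoded instances *)

Lemma nth_map_enum n (T : Type) (x0 : T) (f : 'I_n -> T) (i : 'I_n) :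
  nth x0 [seq f j | j <- enum 'I_n] i = f i.
Proof. by rewrite (nth_map i) ?size_enum_ord // nth_ord_enum. Qed.

Lemma enum_filter (T : finType) (S : {set T}) : enum S = [seq x <- enum T | x \in S].
Proof. by rewrite {1}/enum_mem -enumT. Qed.

Lemma map_enum_ordSl n (T : Type) (f : 'I_n.+1 -> T) :
  [seq f i | i <- enum 'I_n.+1] = f ord0 :: [seq f (lift ord0 i) | i <- enum 'I_n].
Proof. by rewrite enum_ordSl /= -map_comp. Qed.

(** The items of the residual instance are positions in [X]; lists over them become lists over [X],
    which a program can produce. *)
Lemma map_enum_val (T : finType) (S : {set T}) U (f : T -> U) :
  [seq f (enum_val j) | j <- enum 'I_#|S|] = [seq f x | x <- enum S].
Proof.
rewrite map_comp; congr map; case: (set_0Vmem S) => [->|[x0 x0S]].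
  by rewrite enum_set0; apply: size0nil; rewrite size_map size_enum_ord cards0.
have sz : size [seq enum_val j | j <- enum 'I_#|S|] = size (enum S).
  by rewrite size_map size_enum_ord cardE.
apply: (@eq_from_nth _ x0 _ _ sz) => i; rewrite sz -cardE => iS'.
rewrite (nth_map (Ordinal iS')) ?size_enum_ord //.
by rewrite (enum_val_nth x0) nth_enum_ord.
Qed.

(** * Set operations on characteristic bit lists *)

Section Sets.
Variables (A : Type) (ea : A -> data) (n : A -> nat).
Implicit Types S : forall a, {set 'I_(n a)}.

Lemma ptime_mem S (i : forall a, 'I_(n a)) :
  ptime ea (fun a => enc_set (S a)) -> ptime ea (fun a => enc_ord (i a)) ->
  ptime ea (fun a => enc_bool (i a \in S a)).
Proof.
move=> HS Hi; apply: ptime_eq (ptime_nth HS Hi) _ => a.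
exact: (nth_map_enum Nil (fun j => enc_bool (j \in S a))).
Qed.

Hypothesis ptime_n : ptime ea (fun a => enc_unary (n a)).
Let ptime_enum := ptime_enum_ord ptime_n.

Lemma ptime_set S :
  ptime (ext ea (fun a (i : 'I_(n a)) => enc_ord i))
    (fun p => enc_bool (tagged p \in S (tag p))) ->
  ptime ea (fun a => enc_set (S a)).
Proof.
by move=> HS; apply: (ptime_map (f := fun a i => enc_bool (i \in S a)) ptime_enum HS).
Qed.
End Sets.

Lemma ptime_mem_var A (ea : A -> data) (n : A -> nat) (S : forall a, {set 'I_(n a)}) :
  ptime ea (fun a => enc_set (S a)) ->
  ptime (ext ea (fun a (i : 'I_(n a)) => enc_ord i))
    (fun p => enc_bool (tagged p \in S (tag p))).
Proof.
move=> HS; apply: (ptime_mem (n := fun p => n (tag p)) (S := fun p => S (tag p))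
  (i := fun p => tagged p)); [exact: ptime_weak HS | exact: ptime_var].
Qed.

Section SetOperations.
Variables (A : Type) (ea : A -> data) (n : A -> nat).
Variables S T : forall a, {set 'I_(n a)}.
Hypothesis ptime_n : ptime ea (fun a => enc_unary (n a)).
Hypothesis ptime_S : ptime ea (fun a => enc_set (S a)).
Hypothesis ptime_T : ptime ea (fun a => enc_set (T a)).

Lemma ptime_enum_set :
  ptime ea (fun a => enc_seq [seq enc_ord i | i <- enum (S a)]).
Proof.
apply: ptime_eq (ptime_filter (b := fun a i => i \in S a)
  (ptime_enum_ord ptime_n) (ptime_mem_var ptime_S)) _ => a.
by rewrite enum_filter.
Qed.

Lemma ptime_card : ptime ea (fun a => enc_unary #|S a|).
Proof.
by apply: ptime_eq (ptime_unary_size ptime_enum_set) _ => a; rewrite -cardE.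
Qed.

Lemma ptime_setI : ptime ea (fun a => enc_set (S a :&: T a)).
Proof.
apply: (ptime_set (S := fun a => S a :&: T a) ptime_n).
apply: ptime_eq (ptime_and (ptime_mem_var ptime_S) (ptime_mem_var ptime_T)) _ => p.
by rewrite inE.
Qed.

Lemma ptime_setD : ptime ea (fun a => enc_set (S a :\: T a)).
Proof.
apply: (ptime_set (S := fun a => S a :\: T a) ptime_n).
apply: ptime_eq (ptime_and (ptime_neg (ptime_mem_var ptime_T))
  (ptime_mem_var ptime_S)) _ => p.
by rewrite inE.
Qed.

Lemma ptime_set1 (i : forall a, 'I_(n a)) :
  ptime ea (fun a => enc_ord (i a)) -> ptime ea (fun a => enc_set [set i a]).
Proof.
move=> Hi; apply: (ptime_set (S := fun a => [set i a]) ptime_n).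
have Hi' := ptime_weak (T := fun a => 'I_(n a)) (fun a i => enc_ord i) Hi.
have Hj := ptime_var (T := fun a => 'I_(n a)) ea (fun a i => enc_ord i).
apply: ptime_eq (ptime_and (ptime_leq Hi' Hj) (ptime_leq Hj Hi')) _ => p.
by rewrite inE -eqn_leq eq_sym.
Qed.

Lemma ptime_eq_set0 : ptime ea (fun a => enc_bool (S a == set0)).
Proof.
apply: ptime_eq (ptime_all (b := fun a i => i \notin S a) (ptime_enum_ord ptime_n)
  (ptime_neg (ptime_mem_var ptime_S))) _ => a; congr enc_bool.
apply/allP/eqP => [H|->]; last by move=> i; rewrite inE.
by apply/setP => i; rewrite inE; apply/negbTE/H; rewrite mem_enum.
Qed.

End SetOperations.

Section Instances.
Variables (A : Type) (ea : A -> data) (I : A -> pcwcdt).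
Hypothesis ptime_I : ptime ea (fun a => enc_pcwcdt (I a)).

Lemma ptime_dt_n : ptime ea (fun a => enc_unary (dt_n (I a))).
Proof. exact: ptime_hd ptime_I. Qed.

Lemma ptime_dt_m : ptime ea (fun a => enc_unary (dt_m (I a))).
Proof. exact: ptime_hd (ptime_tl ptime_I). Qed.

(** The row of [h] in the matrix of [t] already is the encoding of the reply. *)
Lemma ptime_reply (t : forall a, 'I_(dt_m (I a))) (h : forall a, 'I_(dt_n (I a))) :
  ptime ea (fun a => enc_ord (t a)) -> ptime ea (fun a => enc_ord (h a)) ->
  ptime ea (fun a => enc_set (reply (t a) (h a))).
Proof.
move=> Ht Hh.
pose F a (u : 'I_(dt_m (I a))) (x : 'I_(dt_n (I a))) := enc_set (reply u x).
have H1 := ptime_hd (ptime_tl (ptime_tl ptime_I)).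
have H2 : ptime ea (fun a => enc_seq [seq F a (t a) x | x <- enum 'I_(dt_n (I a))]).
  by apply: ptime_eq (ptime_nth H1 Ht) _ => a; rewrite nth_map_enum.
by apply: ptime_eq (ptime_nth H2 Hh) _ => a; rewrite nth_map_enum.
Qed.

Lemma ptime_prec (s t : forall a, 'I_(dt_m (I a))) :
  ptime ea (fun a => enc_ord (s a)) -> ptime ea (fun a => enc_ord (t a)) ->
  ptime ea (fun a => enc_bool (dt_prec (s a) (t a))).
Proof.
move=> Hs Ht.
have H1 := ptime_hd (ptime_tl (ptime_tl (ptime_tl ptime_I))).
have H2 : ptime ea (fun a =>
    enc_seq [seq enc_bool (dt_prec (s a) u) | u <- enum 'I_(dt_m (I a))]).
  apply: ptime_eq (ptime_nth H1 Hs) _ => a.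
  exact: (nth_map_enum Nil (fun u => enc_seq [seq enc_bool (dt_prec u v) | v <- _])).
apply: ptime_eq (ptime_nth H2 Ht) _ => a.
exact: (nth_map_enum Nil (fun u => enc_bool (dt_prec (s a) u))).
Qed.

Variable X : forall a, {set 'I_(dt_n (I a))}.
Hypothesis ptime_X : ptime ea (fun a => enc_set (X a)).

Lemma ptime_light (t : forall a, 'I_(dt_m (I a))) (h : forall a, 'I_(dt_n (I a))) :
  ptime ea (fun a => enc_ord (t a)) -> ptime ea (fun a => enc_ord (h a)) ->
  ptime ea (fun a => enc_bool (light (X a) (t a) (h a))).
Proof.
move=> Ht Hh; have Hr := ptime_reply Ht Hh; have Hn := ptime_dt_n.
apply: (ptime_leq (i := fun a => #|X a :&: reply (t a) (h a)|)
  (j := fun a => #|X a :\: reply (t a) (h a)|)); apply: ptime_card (Hn) _.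
- exact: ptime_setI Hn ptime_X Hr.
- exact: ptime_setD Hn ptime_X Hr.
Qed.

Lemma ptime_pick_hyp : ptime ea (fun a => enc_ord (pick_hyp (X a))).
Proof.
apply: ptime_eq (ptime_hd (ptime_enum_set ptime_dt_n ptime_X)) _ => a.
(* For empty [X] the default index 0 is encoded by [Nil], which is also [hd Nil]. *)
by rewrite enum_filter /pick_hyp; case: [seq _ <- _ | _].
Qed.

End Instances.

Section Residual.
Variables (A : Type) (ea : A -> data) (I : A -> pcwcdt).
Variable X : forall a, {set 'I_(dt_n (I a))}.
Hypothesis ptime_I : ptime ea (fun a => enc_pcwcdt (I a)).
Hypothesis ptime_X : ptime ea (fun a => enc_set (X a)).

Lemma enc_residual_none (J : pcwcdt) (Y : {set 'I_(dt_n J)}) :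
  enc_set (residual_set Y ord0) = enc_seq [seq enc_bool true | _ <- enum Y].
Proof.
rewrite -map_enum_val /enc_set; congr enc_seq; apply: eq_map => j.
by rewrite /residual_set unlift_none inE.
Qed.

Lemma enc_residual_lift (J : pcwcdt) (Y : {set 'I_(dt_n J)}) t :
  enc_set (residual_set Y (lift ord0 t)) =
  enc_seq [seq enc_bool (light Y t h) | h <- enum Y].
Proof.
rewrite -map_enum_val /enc_set; congr enc_seq; apply: eq_map => j.
by rewrite /residual_set liftK inE.
Qed.

(** The extra set adds a row of ones to the sets. In the order it adds a row that is true only at
    itself and a column of ones. *)
Lemma ptime_residual : ptime ea (fun a => enc_pcsc (residual (X a))).
Proof.
have Hn := ptime_dt_n ptime_I; have Hm := ptime_dt_m ptime_I.
have HX := ptime_enum_set Hn ptime_X.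
pose eat := ext ea (fun a (t : 'I_(dt_m (I a))) => enc_ord t).
have It : ptime eat (fun p => enc_pcwcdt (I (tag p))) by exact: ptime_weak ptime_I.
have Xt : ptime eat (fun p => enc_set (X (tag p))) by exact: ptime_weak ptime_X.
have vt : ptime eat (fun p => enc_ord (tagged p)) by exact: ptime_var.
have HXt := ptime_enum_set (ptime_dt_n It) Xt.
apply: ptime_cons; first exact: ptime_card Hn ptime_X.
apply: ptime_cons; first exact: ptime_cons (ptime_nil _) Hm.
apply: ptime_cons.
  have H0 : ptime ea (fun a => enc_set (residual_set (X a) ord0)).
    apply: ptime_eq (ptime_map (f := fun=> fun=> enc_bool true) HX (ptime_const _ _)) _.
    by move=> a; rewrite enc_residual_none.
  have Ht : ptime eat
      (fun p => enc_set (residual_set (X (tag p)) (lift ord0 (tagged p)))).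
    refine (ptime_eq (ptime_map
      (f := fun p h => enc_bool (light (X (tag p)) (tagged p) h)) HXt _) _).
      set eah := ext eat _.
      have Ih : ptime eah (fun p => enc_pcwcdt (I (tag (tag p)))) by exact: ptime_weak It.
      have Xh : ptime eah (fun p => enc_set (X (tag (tag p)))) by exact: ptime_weak Xt.
      have th : ptime eah (fun p => enc_ord (tagged (tag p))) by exact: ptime_weak vt.
      have hh : ptime eah (fun p => enc_ord (tagged p)) by exact: ptime_var.
      by have := ptime_light Ih Xh th hh.
    by move=> p; rewrite enc_residual_lift.
  have Hl := ptime_map (f := fun a t => enc_set (residual_set (X a) (lift ord0 t)))
    (ptime_enum_ord Hm) Ht.
  apply: ptime_eq (ptime_cons H0 Hl) _ => a.
  by rewrite map_enum_ordSl.
apply: ptime_cons; last first.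
  pose half := ((2%:R : rat)^-1)%R.
  exact: (ptime_const ea (Cons (enc_binary `|numq half|%N)
    (Cons (enc_binary `|denq half|%N) Nil))).
have H0 : ptime ea (fun a => enc_seq (enc_bool true ::
    [seq enc_bool false | _ <- enum 'I_(dt_m (I a))])).
  apply: ptime_cons; first exact: ptime_const.
  exact: (ptime_map (f := fun=> fun=> enc_bool false) (ptime_enum_ord Hm)
    (ptime_const _ _)).
have Ht : ptime eat (fun p => enc_seq (enc_bool true ::
    [seq enc_bool (dt_prec (tagged p) u) | u <- enum 'I_(dt_m (I (tag p)))])).
  apply: ptime_cons; first exact: ptime_const.
  apply: (ptime_map (f := fun p u => enc_bool (dt_prec (tagged p) u))
    (ptime_enum_ord (ptime_dt_m It))).
  set eau := ext eat _.
  have Iu : ptime eau (fun p => enc_pcwcdt (I (tag (tag p)))) by exact: ptime_weak It.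
  have tu : ptime eau (fun p => enc_ord (tagged (tag p))) by exact: ptime_weak vt.
  have uu : ptime eau (fun p => enc_ord (tagged p)) by exact: ptime_var.
  by have := ptime_prec Iu tu uu.
have Hl := ptime_map (f := fun a t => enc_seq (enc_bool true ::
  [seq enc_bool (dt_prec t u) | u <- enum 'I_(dt_m (I a))])) (ptime_enum_ord Hm) Ht.
apply: ptime_eq (ptime_cons H0 Hl) _ => a.
rewrite /enc_rel map_enum_ordSl map_enum_ordSl /sc_prec /=.
rewrite /residual_prec unlift_none /=; congr (Cons (Cons _ (enc_seq _)) (enc_seq _)).
  by apply: eq_map => t; rewrite liftK.
apply: eq_map => t; rewrite map_enum_ordSl unlift_none; congr (Cons _ (enc_seq _)).
by apply: eq_map => u; rewrite !liftK.
Qed.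

Variable cover : forall J : pcsc, {set 'I_(sc_m J)}.
Hypothesis ptime_cover : ptime enc_pcsc (fun J => enc_set (cover J)).

(** Dropping the first bit of the encoded cover removes the extra set. *)
Lemma ptime_phase : ptime ea (fun a => enc_set (phase cover (X a))).
Proof.
have H := ptime_comp (h := fun a => residual (X a)) ptime_residual ptime_cover.
apply: ptime_eq (ptime_tl H) _ => a; rewrite /enc_set map_enum_ordSl /=.
by congr enc_seq; apply: eq_map => t; rewrite inE.
Qed.

Lemma ptime_pending (Q : forall a, {set 'I_(dt_m (I a))}) :
  ptime ea (fun a => enc_set (Q a)) ->
  ptime ea (fun a => enc_set (pending (@phase cover _) (X a) (Q a))).
Proof.
move=> HQ.
apply: ptime_eq (ptime_if (ptime_eq_set0 (ptime_dt_m ptime_I) HQ) ptime_phase HQ) _ => a.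
by rewrite /pending; case: ifP.
Qed.

Lemma ptime_reps (t : forall a, 'I_(dt_m (I a))) :
  ptime ea (fun a => enc_ord (t a)) ->
  ptime ea (fun a => enc_seq [seq enc_ord h | h <- reps (X a) (t a)]).
Proof.
move=> Ht; have Hn := ptime_dt_n ptime_I.
apply: (ptime_filter (b := fun a h => (h \in X a) &&
  all (fun h' => (h' \in X a) && (h' \in reply (t a) h) ==> (h <= h'))
    (enum 'I_(dt_n (I a)))) (ptime_enum_ord Hn)).
apply: ptime_and; first exact: ptime_mem_var ptime_X.
set eah := ext ea _.
have Hh : ptime eah (fun p => enc_ord (tagged p)) by exact: ptime_var.
have Xh : ptime eah (fun p => enc_set (X (tag p))) by exact: ptime_weak ptime_X.
have Ih : ptime eah (fun p => enc_pcwcdt (I (tag p))) by exact: ptime_weak ptime_I.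
have Rh : ptime eah (fun p => enc_set (reply (t (tag p)) (tagged p))).
  have Hth : ptime eah (fun p => enc_ord (t (tag p))) by exact: ptime_weak Ht.
  by have := ptime_reply Ih Hth Hh.
refine (ptime_all (b := fun p (h' : 'I_(dt_n (I (tag p)))) => (h' \in X (tag p)) &&
  (h' \in reply (t (tag p)) (tagged p)) ==>
    ((tagged p : 'I_(dt_n (I (tag p)))) <= h'))
  (ptime_enum_ord (ptime_dt_n Ih)) _).
apply: ptime_imp.
  exact: (ptime_and (ptime_mem_var Xh) (ptime_mem_var Rh)).
exact: ptime_leq (ptime_weak _ Hh) (ptime_var _ _).
Qed.

End Residual.

Lemma ptime_minimal A (ea : A -> data) (I : A -> pcwcdt)
    (Q : forall a, {set 'I_(dt_m (I a))}) :
  ptime ea (fun a => enc_pcwcdt (I a)) -> ptime ea (fun a => enc_set (Q a)) ->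
  ptime ea (fun a => enc_seq [seq enc_ord t | t <- minimal (Q a)]).
Proof.
move=> ptime_I HQ; have Hm := ptime_dt_m ptime_I.
apply: (ptime_filter (b := fun a t => (t \in Q a) &&
  all (fun s => (s \in Q a) && dt_prec s t ==> dt_prec t s)
    (enum 'I_(dt_m (I a)))) (ptime_enum_ord Hm)).
apply: ptime_and; first exact: ptime_mem_var HQ.
set eat := ext ea _.
have Ht : ptime eat (fun p => enc_ord (tagged p)) by exact: ptime_var.
have Qt : ptime eat (fun p => enc_set (Q (tag p))) by exact: ptime_weak HQ.
have It : ptime eat (fun p => enc_pcwcdt (I (tag p))) by exact: ptime_weak ptime_I.
refine (ptime_all (b := fun p (s : 'I_(dt_m (I (tag p)))) => (s \in Q (tag p)) &&
  dt_prec s (tagged p) ==> dt_prec (tagged p) s)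
  (ptime_enum_ord (ptime_dt_m It)) _).
set eas := ext eat _.
have Hs : ptime eas (fun p => enc_ord (tagged p)) by exact: ptime_var.
have Hts : ptime eas (fun p => enc_ord (tagged (tag p))) by exact: ptime_weak Ht.
have Is : ptime eas (fun p => enc_pcwcdt (I (tag (tag p)))) by exact: ptime_weak It.
apply: ptime_imp; last by have := ptime_prec Is Hts Hs.
by apply: ptime_and; [exact: ptime_mem_var Qt | by have := ptime_prec Is Hs Hts].
Qed.

(* [Expand L X Q] evaluates to the edge with label [L] leading to the tree for
   [X] with pending tests [Q]. *)
Inductive task (I : pcwcdt) :=
  | Push of data
  | Build
  | Expand of {set 'I_(dt_n I)} & {set 'I_(dt_n I)} & {set 'I_(dt_m I)}.
Arguments Push {I}.
Arguments Build {I}.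

(** With [Build] encoded by [Nil], a block of [Build] tasks is a unary number. The head of the
    encoding differs from [Nil] only for [Expand]. *)
Definition enc_task (I : pcwcdt) (t : task I) : data :=
  match t with
  | Push d => Cons Nil d
  | Build => Nil
  | Expand L X Q =>
      Cons (Cons Nil Nil) (Cons (enc_set L) (Cons (enc_set X) (enc_set Q)))
  end.

Record node := NodeOf {
  node_I : pcwcdt;
  node_label : {set 'I_(dt_n node_I)};
  node_X : {set 'I_(dt_n node_I)};
  node_Q : {set 'I_(dt_m node_I)} }.

Definition enc_node (s : node) : data :=
  Cons (enc_pcwcdt (node_I s)) (Cons (enc_set (node_label s))
    (Cons (enc_set (node_X s)) (enc_set (node_Q s)))).

(** * The stack machine that carries out the recursion *)

Section Machine.
Variable cover : forall J : pcsc, {set 'I_(sc_m J)}.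
Hypothesis ptime_cover : ptime enc_pcsc (fun J => enc_set (cover J)).

Definition edge_tasks (I : pcwcdt) (X : {set 'I_(dt_n I)}) Q t :
    seq (task I) :=
  [seq Expand (reply t h) (X :&: reply t h) (pending (@phase cover _) X Q :\ t)
  | h <- reps X t].

(** One [Build] per edge assembles the edge list on top of [Nil]; three more put the test, the node
    tag and the label in front of it. *)
Definition node_tasks (I : pcwcdt) (L X : {set 'I_(dt_n I)}) Q t :
    seq (task I) :=
  [:: Push (enc_set L), Push (Cons Nil Nil), Push (enc_ord t) &
     edge_tasks X Q t ++ Push Nil :: nseq (size (reps X t)).+3 Build].

Definition expand (I : pcwcdt) (L X : {set 'I_(dt_n I)}) Q : seq (task I) :=
  if #|X| <= 1 then [:: Push (Cons (enc_set L) (Cons Nil (enc_ord (pick_hyp X))))]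
  else head [::] [seq node_tasks L X Q t | t <- minimal (pending (@phase cover _) X Q)].

Lemma ptime_expand : ptime enc_node (fun s =>
  enc_seq [seq enc_task t | t <- expand (node_label s) (node_X s) (node_Q s)]).
Proof.
have He : ptime enc_node enc_node by exact: ptime_id.
have HI : ptime enc_node (fun s => enc_pcwcdt (node_I s)) := ptime_hd He.
have HL : ptime enc_node (fun s => enc_set (node_label s)) := ptime_hd (ptime_tl He).
have HX : ptime enc_node (fun s => enc_set (node_X s)) :=
  ptime_hd (ptime_tl (ptime_tl He)).
have HQ : ptime enc_node (fun s => enc_set (node_Q s)) :=
  ptime_tl (ptime_tl (ptime_tl He)).
have Hn := ptime_dt_n HI; have Hm := ptime_dt_m HI.
have HP := ptime_pending HI HX ptime_cover HQ.
set pend := fun s => pending (@phase cover _) (node_X s) (node_Q s).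
have leaf : ptime enc_node (fun s => enc_seq [seq enc_task t | t <- [:: @Push (node_I s)
    (Cons (enc_set (node_label s)) (Cons Nil (enc_ord (pick_hyp (node_X s)))))]]).
  apply: ptime_cons (ptime_nil _); apply: ptime_cons (ptime_nil _) _.
  apply: ptime_cons HL _; apply: ptime_cons (ptime_nil _) _.
  by have := ptime_pick_hyp HI HX.
set eat := ext enc_node (fun s (t : 'I_(dt_m (node_I s))) => enc_ord t).
have Ht : ptime eat (fun p => enc_ord (tagged p)) by exact: ptime_var.
have It : ptime eat (fun p => enc_pcwcdt (node_I (tag p))) by exact: ptime_weak HI.
have Lt : ptime eat (fun p => enc_set (node_label (tag p))) by exact: ptime_weak HL.
have Xt : ptime eat (fun p => enc_set (node_X (tag p))) by exact: ptime_weak HX.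
have Pt : ptime eat (fun p => enc_set (pend (tag p))) by exact: ptime_weak HP.
have Dt : ptime eat (fun p => enc_set (pend (tag p) :\ tagged p)).
  by have := ptime_setD (ptime_dt_m It) Pt (ptime_set1 (ptime_dt_m It) Ht).
have reps_t := ptime_reps It Xt Ht.
have edges : ptime eat (fun p => enc_seq [seq enc_task e |
    e <- edge_tasks (node_X (tag p)) (node_Q (tag p)) (tagged p)]).
  refine (ptime_eq (ptime_map (f := fun p h => enc_task (Expand (reply (tagged p) h)
    (node_X (tag p) :&: reply (tagged p) h) (pend (tag p) :\ tagged p))) reps_t _) _);
    last by move=> p; rewrite /edge_tasks -map_comp.
  set eah := ext eat _.
  have Ih : ptime eah (fun p => enc_pcwcdt (node_I (tag (tag p)))).
    exact: ptime_weak It.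
  have Hth : ptime eah (fun p => enc_ord (tagged (tag p))) by exact: ptime_weak Ht.
  have Hh : ptime eah (fun p => enc_ord (tagged p)) by exact: ptime_var.
  have Xh : ptime eah (fun p => enc_set (node_X (tag (tag p)))) by exact: ptime_weak Xt.
  have Rh := ptime_reply Ih Hth Hh.
  apply: ptime_cons (ptime_const _ (Cons Nil Nil)) _.
  apply: ptime_cons (Rh) _; apply: ptime_cons; last exact: ptime_weak Dt.
  by have := ptime_setI (ptime_dt_n Ih) Xh Rh.
have nodes : ptime eat (fun p => enc_seq [seq enc_task e |
    e <- node_tasks (node_label (tag p)) (node_X (tag p)) (node_Q (tag p)) (tagged p)]).
  apply: ptime_cons (ptime_cons (ptime_nil _) Lt) _.
  apply: ptime_cons (ptime_const _ (Cons Nil (Cons Nil Nil))) _.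
  apply: ptime_cons (ptime_cons (ptime_nil _) Ht) _.
  have tail : ptime eat (fun p => enc_seq (Cons Nil Nil ::
      nseq (size (reps (node_X (tag p)) (tagged p))).+3 Nil)).
    apply: ptime_cons (ptime_const _ (Cons Nil Nil)) _.
    do 3 apply: ptime_cons (ptime_nil _) _.
    exact: ptime_unary_size reps_t.
  have E J (s : seq (task J)) k : enc_seq ([seq enc_task e | e <- s] ++
      Cons Nil Nil :: nseq k Nil) =
      enc_seq [seq enc_task e | e <- s ++ Push Nil :: nseq k Build].
    by rewrite map_cat /= map_nseq.
  by apply: ptime_eq (ptime_cat edges tail) _ => p; exact: E.
have list := ptime_map (f := fun s t => enc_seq [seq enc_task e |
  e <- node_tasks (node_label s) (node_X s) (node_Q s) t]) (ptime_minimal HI HP) nodes.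
have one := ptime_leq (ptime_card Hn HX) (ptime_const enc_node (enc_unary 1)).
apply: ptime_eq (ptime_if one leaf (ptime_hd list)) _ => s.
rewrite /expand; case: ifP => // _.
by rewrite -/(pend s); case: (minimal (pend s)).
Qed.

Record config := Config {
  config_I : pcwcdt;
  config_tasks : seq (task config_I);
  config_values : data }.

Definition enc_config (c : config) : data :=
  Cons (enc_pcwcdt (config_I c))
    (Cons (enc_seq [seq enc_task t | t <- config_tasks c]) (config_values c)).

(* The tasks are a program in postfix notation for a stack of values. *)
Definition step (c : config) : config :=
  match config_tasks c with
  | [::] => c
  | Push d :: ts => Config ts (Cons d (config_values c))
  | Build :: ts =>
      let v := config_values c in
      Config ts (Cons (Cons (hd (tl v)) (hd v)) (tl (tl v)))
  | Expand L X Q :: ts => Config (expand L X Q ++ ts) (config_values c)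
  end.

Lemma ptime_step : ptime enc_config (fun c => enc_config (step c)).
Proof.
have He : ptime enc_config enc_config by exact: ptime_id.
have HI := ptime_hd He; have HT := ptime_hd (ptime_tl He).
have HV := ptime_tl (ptime_tl He).
pose T := {s : node & (seq (task (node_I s)) * data)%type}.
pose dest (p : T) : config :=
  (* A configuration whose first task is an [Expand] is viewed as a node with the remaining tasks
     and values, so that [ptime_expand] applies to the node. *)
  @Config (node_I (tag p)) (Expand (node_label (tag p)) (node_X (tag p)) (node_Q (tag p))
    :: (tagged p).1) (tagged p).2.
apply: (ptime_case (e1 := fun p => enc_config (dest p))
  (f1 := fun p => enc_config (step (dest p))) (ptime_hd (ptime_hd HT)) _
  (ptime_ifd HT (ptime_ifd (ptime_hd HT)
     (ptime_cons HI (ptime_cons (ptime_tl HT) (ptime_cons (ptime_tl (ptime_hd HT)) HV)))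
     (ptime_cons HI (ptime_cons (ptime_tl HT) (ptime_cons
       (ptime_cons (ptime_hd (ptime_tl HV)) (ptime_hd HV)) (ptime_tl (ptime_tl HV))))))
     He)); last 2 first.
- move=> [I [|[d| |L X Q] ts] v] //= _.
  by exists (existT _ (NodeOf L X Q) (ts, v)).
- by move=> c ntr; exists c => //; case: c ntr => I [|[d| |L X Q] ts] v.
set e1 := fun p => _.
have He1 : ptime e1 e1 by exact: ptime_id.
have HI1 := ptime_hd He1; have HT1 := ptime_hd (ptime_tl He1).
have HV1 := ptime_tl (ptime_tl He1).
have Hnode : ptime e1 (fun p => enc_node (tag p)).
  exact: (ptime_cons HI1 (ptime_tl (ptime_hd HT1))).
have Hx := ptime_comp (h := tag) Hnode ptime_expand.
have Hts : ptime e1 (fun p => enc_seq [seq enc_task t | t <- (tagged p).1]).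
  exact: ptime_tl HT1.
apply: ptime_eq (ptime_cons HI1 (ptime_cons (ptime_cat Hx Hts) HV1)) _ => p.
by rewrite -map_cat.
Qed.
End Machine.

(** * Running time of the stack machine *)

Lemma dsize_enc_set n (S : {set 'I_n}) : dsize (enc_set S) <= 4 * n + 1.
Proof.
rewrite dsize_enc_seq size_map size_enum_ord addn1 ltnS.
have H (s : seq 'I_n) :
    sumn (map dsize [seq enc_bool (i \in S) | i <- s]) <= 3 * size s.
  by elim: s => //= i s IH; case: (i \in S) => /=; lia.
by have := H (enum 'I_n); rewrite size_enum_ord; lia.
Qed.

Lemma dsize_enc_pcwcdt I : 2 * (dt_n I + dt_m I) <= dsize (enc_pcwcdt I).
Proof.
have H n : dsize (enc_unary n) = 2 * n + 1.
  by rewrite dsize_enc_seq size_nseq map_nseq sumn_nseq /=; lia.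
by rewrite /enc_pcwcdt /= !H; lia.
Qed.

Lemma dsize_enc_node s : dsize (enc_node s) <= 20 * dsize (enc_pcwcdt (node_I s)).
Proof.
case: s => I L X Q.
have H p l x q : dsize (Cons p (Cons l (Cons x q))) =
  dsize p + dsize l + dsize x + dsize q + 3 by rewrite /=; lia.
rewrite [leqLHS]H -[node_I _]/I -[node_X _]/X -[node_Q _]/Q -[node_label _]/L.
have := dsize_enc_set L; have := dsize_enc_set X; have := dsize_enc_set Q.
have := dsize_gt0 (enc_pcwcdt I); have := dsize_enc_pcwcdt I.
move: (dsize _) (dsize _) (dsize _) (dsize _) => *; lia.
Qed.

Lemma dsize_enc_config I (ts : seq (task I)) v :
  dsize (enc_config (Config ts v)) = dsize (enc_pcwcdt I) +
    dsize (enc_seq [seq enc_task t | t <- ts]) + dsize v + 2.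
Proof.
have H p t : dsize (Cons p (Cons t v)) = dsize p + dsize t + dsize v + 2.
  by rewrite /=; lia.
exact: H.
Qed.

Section Run.
Variable cover : forall J : pcsc, {set 'I_(sc_m J)}.
Local Notation step := (step cover).

Lemma step_config_I c : config_I (step c) = config_I c.
Proof. by case: c => I [|[d| |L X Q] ts] v. Qed.

(** Growth is additive: a step rearranges what is there, adds a few cells, or expands a node whose
    size is linear in the instance, however large the configuration is. *)
Lemma iter_step_dsize : ptime enc_pcsc (fun J => enc_set (cover J)) ->
  exists2 G, poly_bounded G & forall c i, dsize (enc_config (iter i step c)) <=
    dsize (enc_config c) + i * G (dsize (enc_pcwcdt (config_I c))).
Proof.
move=> /ptime_expand/ptime_dsize[e [k H]].
exists (fun s => e * (20 * s) ^ k + 5); first by poly_bound.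
move=> c; set G := _ + 5.
elim=> [|i IH]; first by rewrite addn0.
have EI j : config_I (iter j step c) = config_I c.
  by elim: j => //= j IHj; rewrite step_config_I.
rewrite iterS mulSn addnCA; apply: leq_trans (leq_add (leqnn G) IH).
have {EI} : e * (20 * dsize (enc_pcwcdt (config_I (iter i step c)))) ^ k + 5 <= G.
  by rewrite EI.
case: (iter i step c) => I [|[d| |L X Q] ts] v hG.
- by rewrite /step /=; lia.
- by rewrite -[step _]/(Config ts (Cons d v)) !dsize_enc_config /=; lia.
- rewrite -[step _]/(Config ts (Cons (Cons (hd (tl v)) (hd v)) (tl (tl v)))).
  have {hG} G5 : 5 <= G by apply: leq_trans hG; rewrite leq_addl.
  by rewrite !dsize_enc_config; case: v => [|a [|b r]] /=; lia.
have hN := dsize_enc_node (NodeOf L X Q).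
have {H}hX := leq_trans (H (NodeOf L X Q)) (leq_exp e k hN).
have {hN}hX : dsize (enc_seq [seq enc_task t | t <- expand cover L X Q]) + 5 <= G.
  by apply: leq_trans hG; rewrite leq_add2r; exact: hX.
move: hX; rewrite -[step _]/(Config (expand cover L X Q ++ ts) v).
rewrite !dsize_enc_config map_cat.
have E s t : dsize (enc_seq (s ++ t)) < dsize (enc_seq s) + dsize (enc_seq t).
  by rewrite !dsize_enc_seq map_cat sumn_cat size_cat; lia.
have := E [seq enc_task t | t <- expand cover L X Q] [seq enc_task t | t <- ts].
have : dsize (enc_seq [seq enc_task t | t <- ts]) <=
    dsize (enc_seq [seq enc_task t | t <- Expand L X Q :: ts]) by rewrite /=; lia.
by lia.
Qed.

Variable I : pcwcdt.

Lemma iter_build es ts acc vs :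
  iter (size es) step (@Config I (nseq (size es) (@Build I) ++ ts)
    (Cons acc (foldl (fun v e => Cons e v) vs es))) =
  Config ts (Cons (foldr Cons acc es) vs).
Proof.
elim/last_ind: es acc => // es e IH acc.
by rewrite size_rcons iterSr foldl_rcons foldr_rcons -IH.
Qed.

Local Notation pend := (pending (@phase cover I)).
Local Notation tree := (build (@phase cover I)).
Hypothesis pendingP : forall k (X : {set 'I_(dt_n I)}) Q M, 1 < #|X| ->
  fuel_inv k X Q M ->
  exists2 M', fuel_inv k X (pend X Q) M' & pend X Q != set0.

(** The children split [X] into disjoint sets and have one unit of fuel less, so together they take
    10 |X| (k - 1) steps; the node itself takes at most |X| + 8 <= 10 |X|. *)
Lemma run_expand k X Q M L ts vs : fuel_inv k X Q M ->
  exists2 N, N <= 10 * #|X| * k &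
    iter N step (Config (Expand L X Q :: ts) vs) =
    Config ts (Cons (Cons (enc_set L) (enc_dtree (tree k X Q))) vs).
Proof.
elim: k X Q M L ts vs => [|k IH] X Q M L ts vs inv.
  by have [_ _] := inv; have := fuel_inv_gt0 inv; lia.
have X0 : 0 < #|X| by rewrite card_gt0; case: inv.
case: (leqP #|X| 1) => X1.
  exists 2; first by rewrite mulnS; lia.
  by rewrite /= /step /= /expand X1.
have [M' inv' P0] := pendingP X1 inv.
have [t [r E]] := minimal_cons P0; have [tP _] := minimal_mem E.
pose edge h := Cons (enc_set (reply t h))
  (enc_dtree (tree k (X :&: reply t h) (pend X Q :\ t))).
have edges hs us ws : all (mem X) hs ->
    exists2 N, N <= \sum_(h <- hs) 10 * #|X :&: reply t h| * k &
      iter N step (Config ([seq Expand (reply t h) (X :&: reply t h) (pend X Q :\ t)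
        | h <- hs] ++ us) ws) =
      Config us (foldl (fun v e => Cons e v) ws [seq edge h | h <- hs]).
  elim: hs ws => [|h hs IHs] ws /=; first by exists 0.
  case/andP => hX hsX; rewrite big_cons.
  have [N1 le1 run1] := IH _ _ _ (reply t h)
    ([seq Expand (reply t h) (X :&: reply t h) (pend X Q :\ t) | h <- hs] ++ us)
    ws (child_inv inv' tP hX).
  have [N2 le2 run2] := IHs (Cons (edge h) ws) hsX.
  exists (N2 + N1); first by rewrite [N2 + N1]addnC leq_add.
  by rewrite iterD run1 run2.
have [|N leN runN] := edges (reps X t)
    (Push Nil :: nseq (size (reps X t)).+3 Build ++ ts)
    (Cons (enc_ord t) (Cons (Cons Nil Nil) (Cons (enc_set L) vs))).
  by apply/allP => h /mem_reps[].
set rs := reps X t in runN leN.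
(* From right to left: expanding and pushing label, tag and test; evaluating the edges; pushing
   [Nil]; one [Build] per edge; the last three [Build]. *)
exists (3 + (size rs + (1 + (N + 4)))).
  have card_r : \sum_(h <- rs) 10 * #|X :&: reply t h| * k <= 10 * #|X| * k.
    by rewrite -big_distrl -big_distrr /= leq_mul2r leq_mul2l reps_card !orbT.
  have size_r : size rs <= #|X|.
    apply: leq_trans (reps_card X t); rewrite -sum1_size -/rs !big_seq.
    apply: leq_sum => h /mem_reps[hX _]; rewrite card_gt0; apply/set0Pn; exists h.
    by rewrite inE hX mem_reply.
  by have {leN card_r} := leq_trans leN card_r; rewrite mulnS; lia.
rewrite 3!iterD [iter (N + 4) _ _]iterD.
have -> : iter 4 step (Config (Expand L X Q :: ts) vs) = Config
    ([seq Expand (reply t h) (X :&: reply t h) (pend X Q :\ t) | h <- rs] ++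
      Push Nil :: nseq (size rs).+3 Build ++ ts)
    (Cons (enc_ord t) (Cons (Cons Nil Nil) (Cons (enc_set L) vs))).
  rewrite 3!iterSr {4}/step /= /expand leqNgt X1 /= E /= /node_tasks /edge_tasks.
  by rewrite -catA.
rewrite runN -[(size rs).+3]addn3 nseqD -catA.
rewrite -[iter 1 _ _]/(Config (nseq (size rs) Build ++ nseq 3 Build ++ ts) (Cons Nil _)).
rewrite -(size_map edge rs) iter_build.
rewrite -[iter 3 _ _]/(Config ts (Cons (Cons (enc_set L) (Cons (Cons Nil Nil)
  (Cons (enc_ord t) (enc_seq [seq edge h | h <- rs])))) vs)).
rewrite [tree _ _ _]/= leqNgt X1 /= E /= -map_comp.
by [].
Qed.
End Run.

(** * Approximation guarantee and running time of the whole algorithm *)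

Definition tree_of (cover : forall J : pcsc, {set 'I_(sc_m J)}) (I : pcwcdt) :
    dtree (dt_n I) (dt_m I) :=
  build (@phase cover I) ((dt_m I).+1 * dt_n I) setT set0.

Lemma fuel_inv_init I : fuel_inv ((dt_m I).+1 * dt_n I)
  [set: 'I_(dt_n I)] set0 (dt_n I).
Proof.
split; last by rewrite cards0 addn0.
  by apply/set0Pn; exists (Ordinal (dt_n_gt0 I)); rewrite inE.
by move=> h _; rewrite -[leqRHS]card_ord max_card.
Qed.

Lemma ratio_gt1 (R : realFieldType) (b : R) :
  (1 <= b -> 1 < 5 * b / (5 * b - 1))%R.
Proof. by move=> b1; rewrite ltr_pdivlMr ?five_mul_sub1_gt0 //; lra. Qed.

Section Reduction.
Variables (R : realType) (alpha beta : R).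
Hypotheses (alpha_ge1 : (1 <= alpha)%R) (beta_ge1 : (1 <= beta)%R).
Variable cover : forall J : pcsc, {set 'I_(sc_m J)}.
Hypothesis coverP : forall J : pcsc,
  sc_feasible (ratr (sc_f J) / beta)%R (cover J) /\
  forall opt, is_min (@sc_feasible R J (ratr (sc_f J))) (fun C => #|C|) opt ->
    (#|cover J|%:R <= alpha * opt%:R)%R.

Let alpha_ge0 : (0 <= alpha)%R := le_trans ler01 alpha_ge1.

(** Every precedence-closed [D], optimal or not, bounds each phase by [A] = alpha times its cost, so
    the estimate holds against all of them at once. *)
Lemma tree_pc (I : pcwcdt) D : @pc_dtree I D ->
  pc_dtree (tree_of cover I) /\
  ((cost_W (tree_of cover I))%:R <= alpha / ln (5 * beta / (5 * beta - 1)) *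
     ln (dt_n I)%:R * (cost_W D)%:R)%R.
Proof.
move=> pD.
have [|||||idT clT costT] := @build_correct I (@phase cover I) R
  (5 * beta / (5 * beta - 1))%R (alpha * (cost_W D)%:R)%R (ratio_gt1 beta_ge1)
  _ _ _ _ _ _ _ _ set0 (fuel_inv_init I).
- exact: mulr_ge0.
- by move=> X _; exact: (phase_down coverP).
- by move=> X X1; have := phase_card alpha_ge1 beta_ge1 coverP X1 pD.
- by move=> X h X1 hX; have := phase_class alpha_ge1 beta_ge1 coverP X1 hX pD.
- by move=> s t; rewrite inE.
split=> //; rewrite /cost_W.
have /(bigop.eq_bigmax (cost (tree_of cover I)))[h ->] : 0 < #|'I_(dt_n I)|.
  by rewrite card_ord dt_n_gt0.
apply: le_trans (costT h (in_setT h)) _.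
rewrite /bound cards0 add0r le_eqVlt; apply/orP; left; apply/eqP.
by rewrite -/(cost_W D); ring.
Qed.

(** A precedence-closed tree guarantees that each phase makes progress and hence that the fuel
    suffices; the inputs are restricted accordingly. *)
Lemma ptime_tree : ptime enc_pcsc (fun J => enc_set (cover J)) ->
  ptime (fun a : {I : pcwcdt | exists D, @pc_dtree I D} => enc_pcwcdt (sval a))
    (fun a => enc_dtree (tree_of cover (sval a))).
Proof.
move=> ptime_cover; have [G polyG sizeG] := iter_step_dsize ptime_cover.
set ea := fun a => enc_pcwcdt (sval a).
pose init (a : {I : pcwcdt | exists D, @pc_dtree I D}) : config :=
  Config [:: @Expand (sval a) set0 setT set0] Nil.
pose N (a : {I : pcwcdt | exists D, @pc_dtree I D}) :=
  10 * dt_n (sval a) * ((dt_m (sval a)).+1 * dt_n (sval a)).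
(* The product covers the number of rounds and the growth [G] in each of them, the last summand the
   initial configuration. *)
pose P s := 10 * s * ((1 + s) * s) * (1 + G s) + 60 * s.
have he := ptime_id ea.
have hn : ptime ea (fun a => enc_unary (dt_n (sval a))) by exact: ptime_dt_n he.
have hm : ptime ea (fun a => enc_unary (dt_m (sval a))) by exact: ptime_dt_m he.
have hset n b : ptime ea (fun a => enc_unary (n a)) ->
    ptime ea (fun a => enc_set (if b then setT else set0 : {set 'I_(n a)})).
  move=> H; apply: (ptime_set (S := fun a => if b then setT else set0) H).
  by apply: ptime_eq (ptime_const _ (enc_bool b)) _ => p; case: b; rewrite inE.
have init_ptime : ptime ea (fun a => enc_config (init a)).
  apply: ptime_cons he _; apply: ptime_cons (ptime_nil _).
  apply: ptime_cons (ptime_nil _); apply: ptime_cons.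
    exact: (ptime_const _ (Cons Nil Nil)).
  apply: ptime_cons (hset _ false hn) _.
  exact: ptime_cons (hset _ true hn) (hset _ false hm).
have halted a : iter (N a) (step cover) (init a) =
    @Config (sval a) [::]
      (Cons (Cons (@enc_set (dt_n (sval a)) set0)
        (enc_dtree (tree_of cover (sval a)))) Nil).
  case: a => I [D pD] /=.
  have [k X Q M X1 inv|M leM run] := @run_expand cover I _ _ _ _ _ set0 [::] Nil
      (fuel_inv_init I).
    have [|||M' [inv' P0 _]] := @pending_inv I (@phase cover I) R
      (5 * beta / (5 * beta - 1))%R (alpha * (cost_W D)%:R)%R
      (ratio_gt1 beta_ge1) _ _ _ k X Q M X1 inv.
    - exact: mulr_ge0.
    - by move=> Y Y1; have := phase_card alpha_ge1 beta_ge1 coverP Y1 pD.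
    - by move=> Y h Y1 hY; have := phase_class alpha_ge1 beta_ge1 coverP Y1 hY pD.
    by exists M'.
  rewrite cardsT card_ord in leM.
  (* Without tasks the machine idles, so rounds beyond the halting time are harmless. *)
  rewrite /N -(subnK leM) iterD run; elim: (_ - M) => //= i ->.
  by [].
suff H : ptime ea (fun a => enc_config (iter (N a) (step cover) (init a))).
  (* The only value left is an edge with dummy label [set0]; its second component is the tree. *)
  apply: ptime_eq (ptime_tl (ptime_hd (ptime_tl (ptime_tl H)))) _ => a.
  by rewrite halted.
apply: (ptime_while (ts := fun c => enc_seq [seq enc_task t | t <- config_tasks c])
   (P := P) init_ptime).
- exact: ptime_hd (ptime_tl (ptime_id enc_config)).
- exact: ptime_step.
- by rewrite /P; poly_bound.
- move=> a; have := dsize_enc_pcwcdt (sval a); rewrite -/(ea a) => hs.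
  rewrite /N /P; set s := dsize (ea a) in hs *.
  have : 10 * dt_n (sval a) * ((dt_m (sval a)).+1 * dt_n (sval a)) <=
    10 * s * ((1 + s) * s) by rewrite !leq_mul //; lia.
  by move/leq_trans; apply; rewrite mulnDr muln1; lia.
- move=> a i iN; apply: leq_trans (sizeG (init a) i) _.
  have := dsize_enc_pcwcdt (sval a); rewrite -/(ea a) => hs.
  rewrite -[leqLHS]/(dsize (enc_config (init a)) + i * G (dsize (ea a))) /P.
  set s := dsize (ea a) in hs *.
  have hN : i <= 10 * s * ((1 + s) * s).
    by apply: leq_trans iN _; rewrite !leq_mul //; lia.
  have : i * G s <= 10 * s * ((1 + s) * s) * (1 + G s) by rewrite leq_mul //; lia.
  have : dsize (enc_config (init a)) <= 60 * s.
    rewrite /init dsize_enc_config -/(ea a) -/s /=.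
    have := dsize_enc_set (set0 : {set 'I_(dt_n (sval a))}).
    have := dsize_enc_set [set: 'I_(dt_n (sval a))].
    have := dsize_enc_set (set0 : {set 'I_(dt_m (sval a))}).
    have := dsize_gt0 (ea a); rewrite -/s; lia.
  by lia.
- by move=> [I [|t ts] v].
- by move=> a; rewrite halted.
Qed.

End Reduction.

Local Open Scope ring_scope.

Theorem theorem6 (R : realType) :
  exists2 c : R, 0 < c &
    forall alpha beta : R, 1 <= alpha -> 1 <= beta ->
      pcsc_approx alpha beta ->
      pcwcdt_approx (fun n : nat =>
        c * (alpha / ln (5 * beta / (5 * beta - 1)) * ln n%:R)).
Proof.
exists 1 => // alpha beta a1 b1 [p [c [k H]]].
(* Choice fixes for every instance one cover that the given program outputs. *)
pose sol J := cid (H J Logic.I); pose cover J := projT1 (sol J).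
have coverP J := let: ex_intro _ (And3 _ _ good) := projT2 (sol J) in good.
have ptime_cover : ptime enc_pcsc (fun J => enc_set (cover J)).
  exists p, c, k => J; rewrite /cover; case: (sol J) => y [t [r ht _]] /=.
  by exists t.
have [p' [c' [k' K]]] := ptime_tree a1 b1 coverP ptime_cover.
exists p', c', k' => I [D pD]; have [t r ht] := K (exist _ I (ex_intro _ D pD)).
exists (tree_of cover I), t; split=> //.
split; first by have [] := tree_pc a1 b1 coverP pD.
(* The optimum is the cost of some precedence-closed [D'], to which the estimate applies. *)
move=> opt [[D' pD' <-] _]; rewrite mul1r.
by have [] := tree_pc a1 b1 coverP pD'.
Qed.
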